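(* Let $P(\lambda) := \sum_{j=0}^m \lambda^j A_j$ with $m\ge 1$, $A_j \in \mathbb{C}^{n\times n}$ and $\operatorname{rank}(A_m)=n$, let $\mathbb{S} = \{\lambda_1,\dots,\lambda_s\}$ be a set of $s$ complex scalars, and let $r$ be a positive integer. Let $\mu_\ast\in\mathbb{S}^r$ be a point at which the infimum $\inf_{\mu\in\mathbb{S}^r}\kappa_r(\mu)$ is attained, where $\kappa_r(\mu) := \sup_{\Gamma\in\mathbb{C}^{r(r-1)/2}} \sigma_{-r}\left(\mathcal{Q}(\mu,\Gamma,P)\right)$, and let $\Gamma_\ast\in\mathbb{C}^{r(r-1)/2}$ be a point at which the supremum defining $\kappa_r(\mu_\ast)$ is attained (if $r>n$, it is assumed that this inner supremum is attained). Suppose that the multiplicity assumption and the linear independence assumption hold at $(\mu_\ast,\Gamma_\ast)$. Then: (i) $$\tau_r(\mathbb{S}) = \inf_{\mu\in\mathbb{S}^r}\ \sup_{\Gamma\in\mathbb{C}^{r(r-1)/2}} \sigma_{-r}\left(\mathcal{Q}(\mu,\Gamma,P)\right).$$ (ii) A matrix $\Delta$ of minimal 2-norm such that $\sum_{j=1}^s m_j(P+\Delta)\ge r$ is given by $$\Delta_\ast := -\kappa_r(\mu_\ast)\,\mathcal{U}\mathcal{V}^{+},$$ where $\mathcal{U},\mathcal{V}\in\mathbb{C}^{n\times r}$ are the matrices associated with $(\mu_\ast,\Gamma_\ast)$ described in the context; that is, $\sum_{j=1}^s m_j(P+\Delta_\ast)\ge r$ and $\|\Delta_\ast\|_2=\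tau_r(\mathbb{S})$.
   Context: For $\Delta\in\mathbb{C}^{n\times n}$, $P+\Delta$ denotes the matrix polynomial $\lambda\mapsto P(\lambda)+\Delta$ (only the constant coefficient is perturbed), and $m_j(P+\Delta)$ is the algebraic multiplicity of $\lambda_j$ as an eigenvalue of $P+\Delta$, i.e. the multiplicity of $\lambda_j$ as a root of $\det(P(\lambda)+\Delta)$ (zero if it is not a root). The distance is $$\tau_r(\mathbb{S}) := \inf\Big\{\|\Delta\|_2 : \Delta\in\mathbb{C}^{n\times n},\ \sum_{j=1}^s m_j(P+\Delta)\ge r\Big\}.$$ $\mathbb{S}^r$ is the set of $r$-tuples with entries in $\mathbb{S}$. For $\mu=(\mu_1,\dots,\mu_r)$ and $\Gamma=(\gamma_{ik})_{1\le k<i\le r}\in\mathbb{C}^{r(r-1)/2}$, $C(\mu,\Gamma)$ is the $r\times r$ upper triangular matrix with diagonal entries $\mu_1,\dots,\mu_r$ and with $(k,i)$ entry equal to $\gamma_{ik}$ for $k<i$. Further $$\mathcal{Q}(\mu,\Gamma,P) := \sum_{j=0}^m \left(C(\mu,\Gamma)^j\right)^T\otimes A_j\in\mathbb{C}^{nr\times nr},$$ with $\otimes$ the Kronecker product. $\sigma_{-k}(\cdot)$ denotes the $k$th smallest singular value (counted with multiplicity). $\mathcal{V}^+$ is the Moore–Penrose pseudoinverse, and $\operatorname{vec}$ stacks the columns of a matrix into a vector. Let $U,V\in\mathbb{C}^{nr}$ be a consistent pair of unit left and right singular vectors of $\mathcal{Q}(\mu_\ast,\Gamma_\ast,P)$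 for the singular value $\kappa_r(\mu_\ast)=\sigma_{-r}(\mathcal{Q}(\mu_\ast,\Gamma_\ast,P))$, i.e. $\mathcal{Q}(\mu_\ast,\Gamma_\ast,P)V=\kappa_r(\mu_\ast)U$ and $U^\ast\mathcal{Q}(\mu_\ast,\Gamma_\ast,P)=\kappa_r(\mu_\ast)V^\ast$, and let $\mathcal{U},\mathcal{V}\in\mathbb{C}^{n\times r}$ be defined by $U=\operatorname{vec}(\mathcal{U})$, $V=\operatorname{vec}(\mathcal{V})$. Multiplicity assumption at $(\mu_\ast,\Gamma_\ast)$: the multiplicity of the singular value $\sigma_{-r}(\mathcal{Q}(\mu_\ast,\Gamma_\ast,P))$ is one. Linear independence assumption at $(\mu_\ast,\Gamma_\ast)$: $\operatorname{rank}(\mathcal{V})=r$. *)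

(* Defs.v *)
From HB Require Import structures.
From mathcomp Require Import all_boot all_order all_algebra.
From mathcomp Require Import complex mxtens.
From mathcomp Require Import boolp classical_sets reals constructive_ereal ereal.

Set Implicit Arguments.
Unset Strict Implicit.
Unset Printing Implicit Defensive.

Import Order.TTheory GRing.Theory Num.Theory.
Local Open Scope ring_scope.
Local Open Scope sesquilinear_scope.
Local Open Scope complex_scope.
Local Open Scope classical_set_scope.

Section Norms.
Context {R : realType}.
Local Notation C := R[i].

Definition vnorm2 n (x : 'cV[C]_n) : R :=
  Num.sqrt (\sum_i (Normc.normc (x i 0)) ^+ 2).

Definition mxnorm2 p q (M : 'M[C]_(p, q)) : R :=
  sup [set vnorm2 (M *m x) | x in [set x : 'cV[C]_q | vnorm2 x <= 1]].

(* The square roots of the eigenvalues of M^* M, with multiplicity, in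
   nondecreasing order.  The matrix M^* M is Hermitian, so that spectral_diag
   lists its eigenvalues; see char_poly_singular_values. *)
Definition singular_values n (M : 'M[C]_n) : seq R :=
  sort <=%R
    [seq Num.sqrt (complex.Re (spectral_diag (M ^t* *m M) 0 i))
    | i <- enum 'I_n].

(* The k-th smallest singular value, for 1 <= k <= n. *)
Definition sigma_min k n (M : 'M[C]_n) : R := nth 0 (singular_values M) k.-1.

Definition singular_value_mult n (M : 'M[C]_n) (x : R) : nat :=
  count_mem x (singular_values M).

Definition penrose p q (M : 'M[C]_(p, q)) (X : 'M[C]_(q, p)) : Prop :=
  [/\ M *m X *m M = M, X *m M *m X = X,
      (M *m X) ^t* = M *m X & (X *m M) ^t* = X *m M].

(* Existence and uniqueness are proved in mpinvP and penrose_uniq. *)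
Definition mpinv p q (M : 'M[C]_(p, q)) : 'M[C]_(q, p) := xget 0 [set X | penrose M X].

(* Column stacking: entry j * n + i of vec X is X i j.  The indexing is that of
   the Kronecker product *t, whereas mxvec stacks rows. *)
Definition vec n r (X : 'M[C]_(n, r)) : 'cV[C]_(r * n) :=
  \col_k X (mxtens_unindex k).2 (mxtens_unindex k).1.

Lemma gram_normal p q (M : 'M[C]_(p, q)) : M ^t* *m M \is normalmx.
Proof. by apply/normalmxP; rewrite trmx_mul map_mxM trmxCK. Qed.

Lemma gram_diag p q (M : 'M[C]_(p, q)) i : (M ^t* *m M) i i = \sum_j `|M j i| ^+ 2.
Proof. by rewrite mxE; apply: eq_bigr => j _; rewrite !mxE normCKC. Qed.

Lemma gram_spectral_ge0 n (M : 'M[C]_n) i : 0 <= spectral_diag (M ^t* *m M) 0 i.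
Proof.
set G := M ^t* *m M; set P := spectralmx G.
have /orthomx_spectralP : G \is normalmx := gram_normal M.
rewrite -/P => GE; have Pu : P \in unitmx := spectral_unit G.
have -> : spectral_diag G 0 i = ((M *m P ^t*) ^t* *m (M *m P ^t*)) i i.
  rewrite trmx_mul map_mxM trmxCK !mulmxA -[P *m _ *m M]mulmxA -/G [X in P *m X]GE.
  rewrite -(invmx_unitary (spectral_unitarymx G)) -/P -/G.
  by rewrite !mulmxA mulmxV // mul1mx -mulmxA mulmxV // mulmx1 mxE eqxx.
by rewrite gram_diag sumr_ge0 // => j _; rewrite exprn_ge0.
Qed.

Lemma char_poly_singular_values n (M : 'M[C]_n) :
  char_poly (M ^t* *m M) = \prod_(x <- singular_values M) ('X - ((x ^+ 2)%:C)%:P).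
Proof.
set G := M ^t* *m M.
have -> : char_poly G = \prod_i ('X - (spectral_diag G 0 i)%:P).
  have /orthomx_spectralP GE : G \is normalmx := gram_normal M.
  rewrite [in LHS]GE; set P := spectralmx G; set d := spectral_diag G.
  have Pu : P \in unitmx := spectral_unit G.
  have PpU : map_mx polyC P \in unitmx by rewrite map_unitmx.
  rewrite /char_poly; have -> : char_poly_mx (invmx P *m diag_mx d *m P) =
      invmx (map_mx polyC P) *m char_poly_mx (diag_mx d) *m map_mx polyC P.
    rewrite /char_poly_mx mulmxBr mulmxBl !map_mxM map_invmx; congr (_ - _).
    by rewrite scalar_mxC -mulmxA mulVmx // mulmx1.
  rewrite !det_mulmx mulrAC -det_mulmx mulVmx // det1 mul1r.
  have -> : char_poly_mx (diag_mx d) = diag_mx (\row_i ('X - (d 0 i)%:P)).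
    by apply/matrixP => i j; rewrite !mxE; case: eqP; rewrite ?mulr1n ?mulr0n // subr0.
  by rewrite det_diag; apply: eq_bigr => i _; rewrite mxE.
rewrite (perm_big _ (permEl (perm_sort _ _))) big_map -big_enum /=.
apply: eq_bigr => i _; have := gram_spectral_ge0 M i; rewrite -/G.
case: (spectral_diag G 0 i) => a b; rewrite lecE /= => /andP[/eqP -> a_ge0].
by rewrite sqr_sqrtr.
Qed.

Lemma penrose_uniq p q (M : 'M[C]_(p, q)) X Y : penrose M X -> penrose M Y -> X = Y.
Proof.
move=> [mx1 mx2 mx3 mx4] [my1 my2 my3 my4].
have e1 : M *m X = M *m Y.
  rewrite -mx3 -{1}my1 -mulmxA trmx_mul map_mxM mx3 my3.
  by rewrite !mulmxA mx1.
have e2 : X *m M = Y *m M.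
  rewrite -mx4 -{1}my1 !mulmxA -(mulmxA (X *m M)) trmx_mul map_mxM mx4 my4.
  by rewrite -!mulmxA (mulmxA M X) mx1.
by rewrite -mx2 -mulmxA e1 mulmxA e2 my2.
Qed.

Lemma gram_unit p q (M : 'M[C]_(p, q)) : \rank M = q -> M ^t* *m M \in unitmx.
Proof.
move=> rM; rewrite -row_free_unit -kermx_eq0; apply/eqP/row_matrixP => i.
rewrite row0; set v := row i _.
have vG : v *m (M ^t* *m M) = 0.
  by apply/sub_kermxP; rewrite row_sub.
have w0 : v *m M ^t* = 0.
  set w := v *m M ^t*.
  have ww : w *m w ^t* = 0 by rewrite {2}/w trmx_mul map_mxM trmxCK mulmxA -(mulmxA v) vG mul0mx.
  clearbody w; apply/rowP => j; rewrite mxE; have /matrixP /(_ 0 0) := ww.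
  rewrite mxE [RHS]mxE => /eqP; rewrite psumr_eq0 => [|k _]; last first.
    by rewrite !mxE -normCK exprn_ge0.
  move=> /allP /(_ j); rewrite mem_index_enum => /(_ isT) /=.
  by rewrite !mxE -normCK sqrf_eq0 normr_eq0 => /eqP; rewrite ?mxE.
have fM : row_free (M ^t*) by rewrite /row_free mxrank_map mxrank_tr rM.
by apply: (row_free_inj fM); rewrite w0 mul0mx.
Qed.

Lemma mpinvP p q (M : 'M[C]_(p, q)) : penrose M (mpinv M).
Proof.
suff [X MX] : exists X, penrose M X by exact: (xgetPex 0 (ex_intro [set X | _] X MX)).
have [k [B [D [rB rD ->]]]] : exists k (B : 'M[C]_(p, k)) (D : 'M[C]_(k, q)),
    [/\ \rank B = k, \rank (D ^t*) = k & M = B *m D].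
  exists (\rank M), (col_base M), (row_base M); split; last by rewrite mulmx_base.
    by apply/eqP; exact: col_base_full.
  by rewrite mxrank_map mxrank_tr eq_row_base.
have uB := gram_unit rB.
have uD := gram_unit rD; rewrite trmxCK in uD.
have IBh : (invmx (B ^t* *m B)) ^t* = invmx (B ^t* *m B).
  by rewrite trmx_inv map_invmx trmx_mul map_mxM trmxCK.
have IDh : (invmx (D *m D ^t*)) ^t* = invmx (D *m D ^t*).
  by rewrite trmx_inv map_invmx trmx_mul map_mxM trmxCK.
have := mulVmx uB; have := mulmxV uD; move: IBh IDh; clear.
move: (invmx (B ^t* *m B)) (invmx (D *m D ^t*)) => IB ID IBh IDh.
have := trmxCK D; have := trmxCK B.
move: (B ^t*) (D ^t*) => Bs Ds BsE DsE hD hB.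
exists (Ds *m ID *m (IB *m Bs)).
have MX : B *m D *m (Ds *m ID *m (IB *m Bs)) = B *m (IB *m Bs).
  by rewrite -(mulmxA B) (mulmxA D) (mulmxA D) hD mul1mx.
have XM : Ds *m ID *m (IB *m Bs) *m (B *m D) = Ds *m ID *m D.
  by rewrite -(mulmxA (Ds *m ID)) (mulmxA (IB *m Bs)) -(mulmxA IB) hB mul1mx.
split.
- by rewrite MX -(mulmxA B) (mulmxA (IB *m Bs)) -(mulmxA IB) hB mul1mx.
- by rewrite XM (mulmxA (Ds *m ID *m D)) -(mulmxA (Ds *m ID)) (mulmxA D) hD mulmx1.
- rewrite MX !trmx_mul !map_mxM IBh BsE -mulmxA; congr (_ *m (_ *m _)).
  by rewrite -BsE trmxCK.
- rewrite XM !trmx_mul !map_mxM IDh DsE mulmxA; congr (_ *m _ *m _).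
  by rewrite -DsE trmxCK.
Qed.

Lemma mxnorm2_has_sup p q (M : 'M[C]_(p, q)) :
  has_sup [set vnorm2 (M *m x) | x in [set x : 'cV[C]_q | vnorm2 x <= 1]].
Proof.
split.
  exists (vnorm2 (M *m 0)), 0 => //=; rewrite /vnorm2 big1 ?sqrtr0 // => i _.
  by rewrite mxE Normc.normc0 expr0n.
exists (Num.sqrt (\sum_i (\sum_j Normc.normc (M i j)) ^+ 2)) => _ [x /= x1 <-].
have normcE (z : C) : (Normc.normc z)%:C = `|z| by [].
have normc_ge0 (z : C) : 0 <= Normc.normc z by case: z => a b; exact: sqrtr_ge0.
have xj j : Normc.normc (x j 0) <= 1.
  have : vnorm2 x ^+ 2 <= 1 by rewrite expr_le1 // sqrtr_ge0.
  rewrite sqr_sqrtr ?sumr_ge0 // => [h|i _]; last exact: sqr_ge0.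
  rewrite -(@expr_le1 _ 2) //; apply: le_trans h.
  by rewrite (bigD1 j) //= lerDl sumr_ge0 // => i _; exact: sqr_ge0.
rewrite ler_sqrt ?sumr_ge0 // => [|i _]; last exact: sqr_ge0.
apply: ler_sum => i _; rewrite lerXn2r ?nnegrE ?sumr_ge0 //.
rewrite -lecR normcE rmorph_sum /= mxE; apply: le_trans (ler_norm_sum _ _ _) _.
by apply: ler_sum => j _; rewrite normrM -[leRHS]mulr1 ler_wpM2l // -normcE lecR.
Qed.

Lemma vec_tens n r (A : 'M[C]_n) (B : 'M[C]_r) (X : 'M[C]_(n, r)) :
  (B^T *t A) *m vec X = vec (A *m X *m B).
Proof.
apply/colP => k; case: (mxtens_indexP k) => j i; rewrite !mxE mxtens_indexK /=.
rewrite (reindex (@mxtens_index r n)) /=; last first.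
  by exists (@mxtens_unindex r n) => ? _; rewrite (mxtens_indexK, mxtens_unindexK).
transitivity (\sum_(l < r) \sum_(l' < n)
    (B^T *t A) (mxtens_index (j, i)) (mxtens_index (l, l')) * X l' l).
  rewrite pair_bigA /=; apply: eq_bigr => -[l l'] _ /=.
  by rewrite !mxE !mxtens_indexK.
apply: eq_bigr => l _; rewrite mxE mulr_suml; apply: eq_bigr => l' _.
by rewrite tensmxE !mxE -mulrA mulrC.
Qed.

End Norms.

Section MatrixPolynomials.
Context {R : realType}.
Local Notation C := R[i].

(* The matrix polynomial with coefficients A 0, ..., A m. *)
Definition matpoly m n (A : 'I_m.+1 -> 'M[C]_n) : 'M[{poly C}]_n :=
  \sum_(j < m.+1) 'X^j *: map_mx polyC (A j).

Definition eig_mult n (P : 'M[{poly C}]_n) (lam : C) : nat := mup lam (\det P).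

Definition total_mult m n s (A : 'I_m.+1 -> 'M[C]_n) (S : s.-tuple C)
    (Delta : 'M[C]_n) : nat :=
  \sum_(j < s) eig_mult (matpoly A + map_mx polyC Delta) (tnth S j).

Definition tau m n s (A : 'I_m.+1 -> 'M[C]_n) (S : s.-tuple C) (r : nat) : \bar R :=
  ereal_inf [set (mxnorm2 Delta)%:E
            | Delta in [set Delta : 'M[C]_n | (r <= total_mult A S Delta)%N]].

(* Families (gamma_ik) indexed by the pairs (i, k) with k < i. *)
Definition gammas r := {ffun {p : 'I_r * 'I_r | (p.2 < p.1)%N} -> C}.

(* The entry in position (k, i) is gamma_ik for k < i. *)
Definition Cmx r (mu : r.-tuple C) (Gamma : gammas r) : 'M[C]_r :=
  \matrix_(k, i) if insub (i, k) is Some p then Gamma p else tnth mu i *+ (k == i).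

Definition Qmx m n r (A : 'I_m.+1 -> 'M[C]_n) (mu : r.-tuple C) (Gamma : gammas r) :
    'M[C]_(r * n) :=
  \sum_(j < m.+1) (Cmx mu Gamma ^+ j)^T *t A j.

Definition kappa m n r (A : 'I_m.+1 -> 'M[C]_n) (mu : r.-tuple C) : \bar R :=
  ereal_sup [set (sigma_min r (Qmx A mu Gamma))%:E | Gamma in [set: gammas r]].

(* S^r *)
Definition tuples_of s (S : s.-tuple C) r : set (r.-tuple C) :=
  [set mu : r.-tuple C | {subset mu <= S}].

End MatrixPolynomials.

Arguments tuples_of {R s} S r _.

(* Main.v *)
(**
Call (X, T) an invariant pair of a matrix polynomial L when
L(lambda) X = E(lambda) (lambda - T) for some polynomial matrix E; for
L = P + Delta this says that sum_j A_j X T^j + Delta X = 0.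

Lower bound. If prod_i (lambda - mu_i) divides det (P + Delta), splitting linear
factors off P + Delta on the right yields an invariant pair (X, T) with T upper
triangular of diagonal mu, such that X Z = 0 and T Z = Z C only for Z = 0. For
every C = C(mu, Gamma), a dimension count gives at least r independent Z with
T Z = Z C, and then (X Z, C) is an invariant pair, i.e. Q(P) vec (X Z) =
- vec (Delta X Z). By Courant-Fischer, sigma_{-r} (Q(P)) <= ||Delta||.

Upper bound. (calV, C) is an invariant pair of P + D for D = Delta_*, so the
characteristic polynomial of C divides det (P + D). If kappa > 0, as sigma_{-r}
is simple, maximality in Gamma makes
M = sum_j sum_{a+b=j-1} C^b calU^* A_j calV C^a upper triangular. Now
M C - C M = kappa (calU^* calU - calV^* calV) is Hermitian and strictly upper
triangular, hence zero. So calU calV^+ is a contraction, as calV calV^+ is an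
orthogonal projection.
*)

From HB Require Import structures.
Require Import Defs.
From mathcomp Require Import all_boot all_order all_algebra.
From mathcomp Require Import complex mxtens.
From mathcomp Require Import boolp classical_sets reals constructive_ereal ereal.
From mathcomp Require Import ring lra.

Import Order.TTheory GRing.Theory Num.Theory.
Local Open Scope ring_scope.
Local Open Scope sesquilinear_scope.
Local Open Scope complex_scope.
Local Open Scope classical_set_scope.

Set Implicit Arguments.
Unset Strict Implicit.
Unset Printing Implicit Defensive.

Local Notation "X ^P" := (map_mx polyC X) (at level 2, format "X ^P").

(** * Invariant pairs of matrix polynomials *)

(** Sylvester's identity: the same block determinant is factored into block triangular matrices in
    two ways. *)
Lemma det_1addmxC (K : comPzRingType) p q (A : 'M[K]_(p, q)) (B : 'M[K]_(q, p)) :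
  \det (1%:M + A *m B) = \det (1%:M + B *m A).
Proof.
transitivity (\det (block_mx 1%:M (- A) B 1%:M)).
  have -> : block_mx 1%:M (- A) B 1%:M =
      block_mx (1%:M + A *m B) (- A) 0 1%:M *m block_mx 1%:M 0 B 1%:M.
    rewrite mulmx_block ?(mulmx1, mul1mx, mulmx0, mul0mx, add0r, addr0).
    by rewrite mulNmx addrK.
  by rewrite det_mulmx det_ublock det_lblock !det1 !mulr1.
have -> : block_mx 1%:M (- A) B 1%:M =
    block_mx 1%:M 0 B 1%:M *m block_mx 1%:M (- A) 0 (1%:M + B *m A).
  rewrite mulmx_block ?(mulmx1, mul1mx, mulmx0, mul0mx, add0r, addr0).
  by rewrite mulmxN addrCA addNr addr0.
by rewrite det_mulmx det_ublock det_lblock !det1 !mul1r.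
Qed.

(** The right factor acts as lambda - T on the range of [X] and as the identity on the kernel of
    [W], so Sylvester's identity gives its determinant. The cofactor has to send [X] to [E] and to
    agree with [L] on the kernel of [W]. *)
Lemma invariant_pair_factor (F : fieldType) n r (L : 'M[{poly F}]_n)
    (X : 'M[F]_(n, r)) (W : 'M[F]_(r, n)) (T : 'M[F]_r) (E : 'M[{poly F}]_(n, r)) :
    W *m X = 1%:M -> L *m X^P = E *m char_poly_mx T ->
  exists2 L' : 'M[{poly F}]_n,
    L = L' *m (1%:M + X^P *m (char_poly_mx T - 1%:M) *m W^P)
    & \det L = \det L' * char_poly T.
Proof.
move=> WX LX; have WXc : W^P *m X^P = 1%:M by rewrite -map_mxM WX map_mx1.
set G := 1%:M + _; set K := char_poly_mx T in LX G *.
suff LE : L = (L - (L *m X^P - E) *m W^P) *m G.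
  exists (L - (L *m X^P - E) *m W^P) => //.
  rewrite [in LHS]LE det_mulmx; congr (_ * _).
  by rewrite /G -mulmxA det_1addmxC -mulmxA WXc mulmx1 addrC subrK.
have L'X : (L - (L *m X^P - E) *m W^P) *m X^P = E.
  by rewrite mulmxBl -mulmxA WXc mulmx1 opprB addrC subrK.
rewrite /G mulmxDr mulmx1 !mulmxA L'X mulmxBr mulmx1 -LX.
by rewrite subrK.
Qed.

(** For [u] in the kernel of L(a), every entry of L u vanishes at [a] and is therefore divisible by
    'X - a. *)
Lemma invariant_pair_eigenvector (F : fieldType) n (L : 'M[{poly F}]_n) (a : F) :
    root (\det L) a ->
  exists2 u : 'cV[F]_n, u != 0
    & exists E, L *m u^P = E *m char_poly_mx (a%:M : 'M_1).
Proof.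
move=> La; pose L0 := map_mx (horner_eval a) L.
have /det0P [v v0 vL] : \det L0^T == 0 by rewrite det_tr det_map_mx.
have Lv : L0 *m v^T = 0 by rewrite -[LHS]trmxK trmx_mul trmxK vL trmx0.
exists v^T; first by rewrite -trmx0 (inj_eq trmx_inj).
exists (map_mx (fun p => p %/ ('X - a%:P)) (L *m (v^T)^P)).
apply/matrixP => i j; rewrite [RHS]mxE big_ord1 !ord1 !mxE eqxx /= mulr1n.
rewrite divpK // -root_factor_theorem; apply/rootP.
have /matrixP/(_ i 0) := Lv; rewrite [RHS]mxE => <-.
rewrite horner_sum [RHS]mxE; apply: eq_bigr => l _.
by rewrite hornerM !mxE hornerC.
Qed.

(** A single equation encodes both upper triangularity and the prescribed diagonal. *)
Definition diag_upper (F : fieldType) r (d : seq F) (T : 'M[F]_r) :=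
  forall i j : 'I_r, (j <= i)%N -> T i j = d`_i *+ (i == j).

Lemma diag_upper_block (F : fieldType) r (a : F) (d : seq F) (t : 'rV_r) (T : 'M[F]_r) :
  diag_upper d T -> diag_upper (a :: d) (block_mx (a%:M : 'M_1) t 0 T : 'M_(1 + r)).
Proof.
move=> Td i j; rewrite -(splitK i) -(splitK j).
case: (split i) => i'; case: (split j) => j' /= ji.
- by rewrite block_mxEul !ord1 !mxE eqxx.
- by move: ji; rewrite (ord1 i').
- by rewrite block_mxEdl mxE eq_rlshift.
- by rewrite block_mxEdr Td // eq_rshift.
Qed.

(** As [size mu] may exceed [n], [X] need not have full column rank; the last clause replaces
    injectivity. By induction, one linear factor is split off [L] and the pair of the cofactor is
    bordered. *)
Lemma invariant_pair_exists (F : fieldType) n (mu : seq F) : forall L : 'M[{poly F}]_n,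
    \prod_(x <- mu) ('X - x%:P) %| \det L ->
  exists (X : 'M[F]_(n, size mu)) (T : 'M[F]_(size mu)),
    [/\ diag_upper mu T,
        exists E, L *m X^P = E *m char_poly_mx T
      & forall q (C : 'M_q) (Z : 'M_(size mu, q)),
          T *m Z = Z *m C -> X *m Z = 0 -> Z = 0].
Proof.
elim: mu => [|a mu IHmu] L /=.
  move=> _; exists 0, 0; split; first by case.
    by exists 0; rewrite map_mx0 mulmx0 mul0mx.
  by move=> q C Z _ _; apply/matrixP => -[].
rewrite big_cons => dvdL.
have [|u u0 [E1 Lu]] := @invariant_pair_eigenvector _ _ L a.
  by rewrite root_factor_theorem (dvdp_trans _ dvdL) ?dvdp_mulr.
have [k uk] : exists k, u k 0 != 0 by apply/cV0Pn.
pose w : 'rV[F]_n := (u k 0)^-1 *: delta_mx 0 k.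
have wu : w *m u = 1%:M.
  rewrite -scalemxAl -rowE; apply/matrixP => i j.
  by rewrite !mxE !ord1 mulVf.
have [L' LE detL] := invariant_pair_factor wu Lu.
have ca : char_poly (a%:M : 'M_1) = 'X - a%:P.
  by rewrite /char_poly det_mx11 !mxE eqxx mulr1n.
have [|X' [T' [T'd [E' L'X'] obs]]] := IHmu L'.
  by move: dvdL; rewrite detL ca mulrC dvdp_mul2r // polyXsubC_eq0.
(* [t] solves the condition that the split factor 1 + u (lambda - a - 1) w sends the last columns of
   the pair to [X']. *)
pose t := w *m X' - w *m X' *m (T' - a%:M).
pose X := row_mx u X'; pose T := block_mx (a%:M : 'M_1) t 0 T'.
pose J := row_mx (0 : 'M[F]_(_, 1)) (1%:M : 'M[F]_(size mu)).
(* The factor split off from L maps the pair (X, T) to (X' J, T). *)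
have FX : X - u *m w *m X - a *: (u *m w *m X) + u *m w *m X *m T = X' *m J.
  rewrite /X /T /J !mul_mx_row mul_row_block -!mulmxA wu.
  rewrite !(mulmx0, mulmx1, addr0, scale_row_mx, opp_row_mx, add_row_mx).
  congr row_mx.
    by rewrite !mul_mx_scalar -!scalemxAr wu mulmx1 subrr add0r addNr.
  rewrite (mulmxA w u) wu mul1mx /t mulmxBr mulmxBr mul_mx_scalar -mulmxA mulmxBr -scalemxAr.
  move: (u *m (w *m X')) (u *m (w *m (X' *m T'))) => y z.
  by apply/matrixP => i j; rewrite !mxE; ring.
have JT : J *m T = T' *m J.
  by rewrite /J /T mul_row_block mul_mx_row !(mul0mx, mulmx0, mulmx1, mul1mx, add0r).
exists X, T; split.
- exact: diag_upper_block.
- exists (L' *m (u *m w *m X)^P + E' *m J^P).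
  (* The split factor applied to [X] is divided by lambda - T on the right; [FX] identifies the
     remainder. *)
  have -> : L *m X^P = L' *m ((u *m w *m X)^P *m char_poly_mx T + (X' *m J)^P).
    rewrite {1}LE -[LHS]mulmxA; congr (_ *m _); rewrite -FX.
    have -> : char_poly_mx (a%:M : 'M_1) - 1%:M = ('X - a%:P - 1)%:M.
      by rewrite /char_poly_mx map_scalar_mx /= -!raddfB.
    rewrite mul_mx_scalar -scalemxAl mulmxDl mul1mx -scalemxAl -!map_mxM /char_poly_mx.
    rewrite mulmxBr mul_mx_scalar -map_mxM.
    by apply/matrixP => i j; rewrite !mxE !(rmorphD, rmorphN, rmorphM) /=; ring.
  rewrite mulmxDr (map_mxM _ X') !mulmxA L'X' -[X in _ + X]mulmxA.
  have -> : char_poly_mx T' *m J^P = J^P *m char_poly_mx T.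
    by rewrite /char_poly_mx mulmxBl mulmxBr -!map_mxM JT scalar_mxC.
  by rewrite mulmxA -mulmxDl.
- move=> q C; rewrite -[(size mu).+1]/(1 + size mu)%N => Z TZ XZ.
  (* By [FX], the matrix J Z is killed by [X'], so it vanishes by induction. Only the first row of
     [Z] remains, and w u = 1 forces it to be zero. *)
  have J0 : J *m Z = 0.
    apply: (obs _ C); first by rewrite mulmxA -JT -mulmxA TZ mulmxA.
    rewrite mulmxA -FX !mulmxDl !mulNmx -!scalemxAl -!mulmxA TZ !(mulmxA X) XZ.
    by rewrite !(mul0mx, mulmx0, scaler0, subr0, addr0).
  move: J0 XZ; rewrite -[Z]vsubmxK mul_row_col mul0mx mul1mx add0r mul_row_col => ->.
  rewrite mulmx0 addr0 => uz.
  rewrite (_ : usubmx Z = 0) ?col_mx0 //.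
  by rewrite -[LHS]mul1mx -wu -mulmxA uz mulmx0.
Qed.

Lemma mulmx_diag_upper (F : fieldType) r (P Q : 'M[F]_r) (i j : 'I_r) :
    (forall i j : 'I_r, (j < i)%N -> P i j = 0) ->
    (forall i j : 'I_r, (j < i)%N -> Q i j = 0) -> (j <= i)%N ->
  (P *m Q) i j = P i i * Q j j *+ (i == j).
Proof.
move=> Pup Qup ji; rewrite mxE (bigD1 i) //= big1 ?addr0 => [|k ki].
  have [->|ij] := eqVneq i j; first by [].
  by rewrite Qup ?mulr0 // ltn_neqAle eq_sym ij ji.
have [ltki|leik] := ltnP k i; first by rewrite Pup ?mul0r.
by rewrite Qup ?mulr0 // (leq_ltn_trans ji) // ltn_neqAle eq_sym ki.
Qed.

(** A map that misses one coordinate is not surjective, hence not injective by equality of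
    dimensions. *)
Lemma linear_kernel_neq0 (F : fieldType) p q (h : {linear 'M[F]_(p, q) -> 'M[F]_(p, q)}) i j :
  (forall Z, h Z i j = 0) -> exists2 Z, Z != 0 & h Z = 0.
Proof.
move=> h0; have [fh|] := boolP (row_free (lin_mx h)).
  have := h0 (vec_mx (mxvec (delta_mx i j) *m invmx (lin_mx h))).
  rewrite -[h _]mxvecK -mul_vec_lin vec_mxK mulmxKV -?row_free_unit // mxvecK mxE !eqxx.
  by move=> /eqP; rewrite oner_eq0.
rewrite -kermx_eq0 => /rowV0Pn[v /sub_kermxP vh v0].
exists (vec_mx v); first by rewrite -(inj_eq (can_inj vec_mxK)) linear0 in v0 *.
by apply: (can_inj mxvecK); rewrite -mul_vec_lin vec_mxK vh linear0.
Qed.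

(* Dimension count: on the upper triangular matrices Z, of dimension r(r+1)/2,
   the map TZ - ZC takes strictly upper triangular values, so its kernel has
   dimension at least r. The q < r extra conditions are stored in the unused
   diagonal entries. *)
Lemma upper_intertwiner_exists (F : fieldType) r (d : seq F) (T C : 'M[F]_r) q
    (g : {linear 'M[F]_r -> 'cV[F]_q}) :
    diag_upper d T -> diag_upper d C -> (q < r)%N ->
  exists Z, [/\ Z != 0, T *m Z = Z *m C & g Z = 0].
Proof.
case: r T C g => // r T C g Td Cd ltqr.
(* Below the diagonal [h] returns [Z] itself, so its kernel consists of upper triangular matrices;
   condition number k of [g] sits in diagonal entry k. *)
pose h (Z : 'M[F]_r.+1) := \matrix_(i, j)
  if i == j then (if insub (val i) is Some k then g Z k 0 else 0)
  else if (j < i)%N then Z i j else (T *m Z - Z *m C) i j.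
have hE Z i j : h Z i j = if i == j then (if insub (val i) is Some k then g Z k 0 else 0)
    else if (j < i)%N then Z i j else (T *m Z - Z *m C) i j by rewrite mxE.
have h_lin : linear h.
  move=> a Y Z; apply/matrixP => i j; rewrite [RHS]mxE [(a *: h Y) i j]mxE !hE.
  case: eqP => _; last case: ltnP => _.
  - by case: insub => [k|]; rewrite ?linearP ?mxE // mulr0 addr0.
  - by rewrite !mxE.
  - rewrite mulmxDr mulmxDl -scalemxAr -scalemxAl opprD addrACA -scalerBr.
    by rewrite [LHS]mxE; congr (_ + _); rewrite [LHS]mxE.
pose hL : {linear 'M[F]_r.+1 -> 'M[F]_r.+1} :=
  HB.pack h (GRing.isLinear.Build _ _ _ _ h h_lin).
have [|Z Z0 hZ] := @linear_kernel_neq0 _ _ _ hL ord_max ord_max.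
  (* The index [ord_max] has value r >= q, so [insub] fails and the last diagonal entry is the
     default 0. *)
  move=> Z; change (h Z ord_max ord_max = 0); rewrite hE eqxx insubN // -leqNgt /= -ltnS //.
have hZ0 i j : h Z i j = 0 by rewrite [h Z]hZ mxE.
have Zup (i j : 'I_r.+1) : (j < i)%N -> Z i j = 0.
  by move=> ji; have := hZ0 i j; rewrite hE ji -val_eqE /= gtn_eqF.
exists Z; split=> //; last first.
  apply/colP => k; rewrite [RHS]mxE -(hZ0 (inord k) (inord k)) hE eqxx /= inordK.
    by rewrite (valK k).
  exact: ltn_trans (ltn_ord k) ltqr.
apply/eqP; rewrite -subr_eq0; apply/eqP/matrixP => i j; rewrite [RHS]mxE.
case: (ltnP i j) => [ij|ji].
  by have := hZ0 i j; rewrite hE -val_eqE /= ltn_eqF // ltnNge ltnW.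
have up (P : 'M_r.+1) : diag_upper d P -> forall k l : 'I_r.+1, (l < k)%N -> P k l = 0.
  by move=> Pd k l lk; rewrite Pd ?(ltnW lk) // -val_eqE /= gtn_eqF.
(* On and below the diagonal the equation is automatic: both products are upper triangular, and [T]
   and [C] share their diagonal. *)
rewrite mxE [X in _ + X]mxE !mulmx_diag_upper //; [|exact: up..].
by have [->|_] := eqVneq i j; rewrite ?mulr0n ?subr0 // Td // Cd // mulrC subrr.
Qed.

(** Uniqueness of the remainder on right division by lambda - C: comparing coefficients in positive
    degrees gives E_k = E_(k+1) C, and E_k vanishes for large k, so E = 0. *)
Lemma polyC_eq_mul_char_poly_mx (F : fieldType) p r (C : 'M[F]_r) (K : 'M[F]_(p, r)) E :
  K^P = E *m char_poly_mx C -> K = 0.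
Proof.
pose coE k := map_mx (fun q : {poly F} => q`_k) E.
move=> KE; have coE_step k : coE k = coE k.+1 *m C.
  apply/matrixP => i j; have /matrixP/(_ i j)/(congr1 (fun q : {poly F} => q`_k.+1)) := KE.
  rewrite /char_poly_mx mulmxBr mul_mx_scalar !mxE coefC coefB mulrC coefMX /=.
  move/eqP; rewrite eq_sym subr_eq0 => /eqP ->; rewrite coef_sum; apply: eq_bigr => l _.
  by rewrite !mxE coefMC.
have coE_big k : (\max_i \max_j size (E i j) <= k)%N -> coE k = 0.
  move=> lek; apply/matrixP => i j; rewrite !mxE nth_default //.
  by apply: leq_trans lek; rewrite (bigD1 i) //= leq_max (bigD1 j) //= leq_max leqnn.
have coE0 d k : (\max_i \max_j size (E i j) <= k + d)%N -> coE k = 0.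
  elim: d k => [|d IHd] k; first by rewrite addn0; exact: coE_big.
  by rewrite -addSnnS => /IHd coEk1; rewrite coE_step coEk1 mul0mx.
have E0 : E = 0.
  apply/matrixP => i j; rewrite mxE; apply/polyP => k; rewrite coef0.
  by have /matrixP/(_ i j) := coE0 _ k (leq_addl _ _); rewrite !mxE.
apply/matrixP => i j; apply: polyC_inj.
by have /matrixP/(_ i j) := KE; rewrite E0 mul0mx !mxE.
Qed.

(** * Right division by lambda - T, and the action of Q on vectorised matrices *)

Section MatrixPolynomials.
Variable R : realType.
Local Notation C := R[i].

(** The right value of P(lambda) X at [T], that is, the remainder of P X on right division by lambda
    - T. *)
Definition mxeval m n r (A : 'I_m.+1 -> 'M[C]_n) (X : 'M[C]_(n, r)) (T : 'M[C]_r) :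
    'M[C]_(n, r) := \sum_(j < m.+1) A j *m X *m T ^+ j.

Lemma matpoly_mul_const m n r (A : 'I_m.+1 -> 'M[C]_n) (X : 'M[C]_(n, r)) (T : 'M[C]_r) :
  exists E, matpoly A *m X^P = E *m char_poly_mx T + (mxeval A X T)^P.
Proof.
have powX j : exists S, 'X^j *: X^P = S *m char_poly_mx T + (X *m T ^+ j)^P.
  elim: j => [|j [S IHj]]; first by exists 0; rewrite mul0mx add0r !expr0 scale1r mulmx1.
  (* From lambda X T^j = X T^j (lambda - T) + X T^(j+1). *)
  exists ('X *: S + (X *m T ^+ j)^P).
  rewrite exprS -scalerA IHj scalerDr mulmxDl scalemxAl -addrA; congr (_ + _).
  rewrite exprSr mulmxA (map_mxM _ _ T) -mulmxDr /char_poly_mx subrK.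
  by rewrite mul_mx_scalar.
have [S SE] := choice powX.
exists (\sum_(j < m.+1) (A j)^P *m S j); rewrite /mxeval mulmx_suml mulmx_suml raddf_sum /=.
rewrite -big_split /=. apply: eq_bigr => j _.
by rewrite -scalemxAl scalemxAr SE mulmxDr !map_mxM !mulmxA.
Qed.

(** The left-hand side of the equation is the remainder of (P + D) X on right division by lambda -
    T, and remainders are unique. *)
Lemma invariant_pair_matpolyP m n r (A : 'I_m.+1 -> 'M[C]_n) (D : 'M[C]_n)
    (X : 'M[C]_(n, r)) (T : 'M[C]_r) :
  (exists E, (matpoly A + D^P) *m X^P = E *m char_poly_mx T) <->
  mxeval A X T + D *m X = 0.
Proof.
have [S SE] := matpoly_mul_const A X T.
have LE : (matpoly A + D^P) *m X^P = S *m char_poly_mx T + (mxeval A X T + D *m X)^P.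
  by rewrite mulmxDl SE -addrA map_mxD map_mxM.
split=> [[E EE]|X0]; last by exists S; rewrite LE X0 map_mx0 addr0.
apply: (@polyC_eq_mul_char_poly_mx _ _ _ T _ (E - S)).
by rewrite mulmxBl -EE LE addrAC subrr add0r.
Qed.

Lemma vec_is_linear n r : linear (@vec R n r).
Proof. by move=> a X Y; apply/colP => k; rewrite !mxE. Qed.

HB.instance Definition _ n r :=
  GRing.isLinear.Build C 'M[C]_(n, r) 'cV[C]_(r * n) _ (@vec R n r) (@vec_is_linear n r).

Lemma vec_inj n r : injective (@vec R n r).
Proof.
move=> X Y /colP XY; apply/matrixP => i j.
by have := XY (mxtens_index (j, i)); rewrite !mxE mxtens_indexK.
Qed.

Lemma Qmx_mul_vec m n r (A : 'I_m.+1 -> 'M[C]_n) mu (Gamma : gammas r) (X : 'M[C]_(n, r)) :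
  Qmx A mu Gamma *m vec X = vec (mxeval A X (Cmx mu Gamma)).
Proof.
rewrite mulmx_suml linear_sum; apply: eq_bigr => j _; exact: vec_tens.
Qed.

Lemma Cmx_diag_upper r (mu : r.-tuple C) (Gamma : gammas r) : diag_upper mu (Cmx mu Gamma).
Proof.
move=> i j ji; rewrite mxE insubN /= -?leqNgt // (tnth_nth 0).
by case: eqVneq => [->|].
Qed.

End MatrixPolynomials.

(** * Root multiplicities *)

Lemma prod_XsubC_dvdp (F : fieldType) (mu : seq F) : forall p : {poly F},
  (forall x, count_mem x mu <= mup x p)%N -> \prod_(x <- mu) ('X - x%:P) %| p.
Proof.
elim: mu => [|a mu IHmu] p mup_ge; first by rewrite big_nil dvd1p.
have [->|p0] := eqVneq p 0; first exact: dvdp0.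
have : 'X - a%:P %| p.
  by rewrite XsubC_dvd //; apply: leq_trans (mup_ge a); rewrite /= eqxx.
case/dvdpP=> q pE; rewrite big_cons mulrC pE dvdp_mul2r ?polyXsubC_eq0 //.
have q0 : q != 0 by apply: contraNneq p0 => q0; rewrite pE q0 mul0r.
apply: IHmu => x; move: (mup_ge x); rewrite pE mupM ?polyXsubC_eq0 //=.
rewrite -['X - a%:P]expr1 mup_XsubCX addnC.
by case: (a == x) => /=; rewrite ?add1n ?addn1 ?addn0 ?add0n.
Qed.

Lemma count_mem_sum (T : eqType) (s : seq T) (f : T -> nat) x :
  uniq s -> (\sum_(y <- s) (y == x) * f y = (x \in s) * f x)%N.
Proof.
move=> s_uniq; have [xs|xs] := boolP (x \in s).
  by rewrite (bigD1_seq x) //= eqxx big1 ?addn0 // => y /negPf ->.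
by rewrite big_seq big1 // => y ys; case: eqP => // yx; rewrite -yx ys in xs.
Qed.

Lemma sum_mup_dvdp (F : fieldType) (s : seq F) (p : {poly F}) r :
    uniq s -> (r <= \sum_(x <- s) mup x p)%N ->
  exists mu : r.-tuple F, {subset mu <= s} /\ \prod_(x <- mu) ('X - x%:P) %| p.
Proof.
(* [full] repeats each point of [s] according to its multiplicity; its first r entries form [mu]. *)
move=> s_uniq le_r; pose full := flatten [seq nseq (mup x p) x | x <- s].
have size_full : size full = (\sum_(x <- s) mup x p)%N.
  rewrite size_flatten /shape -map_comp sumnE big_map.
  by apply: eq_bigr => x _; rewrite /= size_nseq.
have size_mu : size (take r full) == r by rewrite size_takel // size_full.
exists (Tuple size_mu); split=> [x /mem_take /flatten_mapP [y ys]|] /=.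
  by rewrite mem_nseq => /andP[_ /eqP ->].
apply: prod_XsubC_dvdp => x.
apply: (@leq_trans (count_mem x full)).
  by rewrite -{2}(cat_take_drop r full) count_cat leq_addr.
rewrite count_flatten -map_comp sumnE big_map.
under eq_bigr => y _ do rewrite /= count_nseq /=.
by rewrite count_mem_sum //; case: (x \in s); rewrite ?mul1n.
Qed.

Lemma leq_sum_mup (F : fieldType) (s mu : seq F) (p : {poly F}) :
    uniq s -> p != 0 -> {subset mu <= s} -> \prod_(x <- mu) ('X - x%:P) %| p ->
  (size mu <= \sum_(x <- s) mup x p)%N.
Proof.
move=> s_uniq p0 mu_s /dvdpP[q pE].
have q0 : q != 0 by apply: contraNneq p0 => q0; rewrite pE q0 mul0r.
have P0 : \prod_(x <- mu) ('X - x%:P) != 0 :> {poly F}.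
  by apply: contraNneq p0 => P0; rewrite pE P0 mulr0.
apply: (@leq_trans (\sum_(x <- s) count_mem x mu)); last first.
  by apply: leq_sum => x _; rewrite pE mupM // mu_prod_XsubC leq_addl.
under eq_bigr => x _ do rewrite -sum1_count big_mkcond /=.
rewrite exchange_big /= -sum1_size big_seq [leqRHS]big_seq.
apply: leq_sum => y /mu_s ys.
rewrite (bigD1_seq y) //= eqxx //.
Qed.

(** If P + D kills a polynomial row [v], the invertible A_m kills the top coefficient of [v], and
    all coefficients vanish from the top down. As m >= 1, the constant [D] does not reach the
    leading term. *)
Lemma det_matpoly_neq0 (R : realType) m n (A : 'I_m.+1 -> 'M[R[i]]_n) (D : 'M_n) :
  (1 <= m)%N -> \rank (A ord_max) = n -> \det (matpoly A + D^P) != 0.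
Proof.
move=> m_ge1 rankAm; apply/negP => /det0P [v v0 vL].
pose co k := map_mx (fun q : {poly R[i]} => q`_k) v.
have coM k (B : 'M_n) : map_mx (fun q : {poly R[i]} => q`_k) (v *m B^P) = co k *m B.
  apply/matrixP => i j; rewrite !mxE coef_sum; apply: eq_bigr => l _.
  by rewrite !mxE coefMC.
have co_step k : (forall l, (k < l)%N -> co l = 0) -> co k = 0.
  move=> co_gt; suff kA : co k *m A ord_max = 0.
    apply: (@row_free_inj _ _ _ _ (A ord_max)); first by rewrite /row_free rankAm.
    by rewrite kA mul0mx.
  transitivity (map_mx (fun q : {poly R[i]} => q`_(k + m)) (v *m (matpoly A + D^P)));
    last by rewrite vL; apply/matrixP => i j; rewrite !mxE coef0.
  apply/matrixP => i j; rewrite mulmxDr mulmx_sumr [RHS]mxE [in RHS]mxE coefD.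
  have /matrixP/(_ i j) := coM (k + m)%N D; rewrite co_gt ?mul0mx;
    last by rewrite -ltn_subLR // subnn.
  rewrite [LHS]mxE [RHS]mxE => ->; rewrite addr0.
  rewrite summxE coef_sum big_ord_recr /= big1 ?add0r => [|l _].
    by rewrite -scalemxAr [in RHS]mxE coefXnM addnK ltnNge leq_addl /= -coM mxE.
  have ltlm := ltn_ord l.
  rewrite -scalemxAr mxE coefXnM ltnNge (leq_trans (ltnW ltlm)) ?leq_addl //=.
  have := coM (k + m - l)%N (A (widen_ord (leqnSn m) l)); rewrite co_gt.
    by rewrite mul0mx => /matrixP/(_ i j); rewrite !mxE.
  by rewrite -addnBA ?(ltnW ltlm) // -ltn_subLR // subnn subn_gt0.
have co_big k : (\max_j size (v 0%R j) <= k)%N -> co k = 0.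
  move=> lek; apply/matrixP => i j; rewrite !mxE ord1 nth_default //.
  by apply: leq_trans lek; rewrite (bigD1 j) //= leq_max leqnn.
have co0 d k : (\max_j size (v 0%R j) <= k + d)%N -> co k = 0.
  elim: d k => [|d IHd] k; first by rewrite addn0; exact: co_big.
  move=> lek; apply: co_step => l ltkl; apply: IHd.
  by apply: leq_trans lek _; rewrite addnS -addSn leq_add2r.
move/negP: v0; apply; apply/eqP/matrixP => i j; rewrite mxE; apply/polyP => k; rewrite coef0.
by have /matrixP/(_ i j) := co0 _ k (leq_addl _ _); rewrite !mxE.
Qed.

(** * Norms *)

Section VectorNorm.
Variable R : realType.
Local Notation C := R[i].
Local Notation normc := Normc.normc.

Lemma normc_ge0 (z : C) : 0 <= normc z.
Proof. by case: z => a b; exact: sqrtr_ge0. Qed.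

Lemma normc_normr (z : C) : (normc z)%:C = `|z|.
Proof. by []. Qed.

Lemma normc_opp (z : C) : normc (- z) = normc z.
Proof. by case: z => a b; rewrite /normc /= !sqrrN. Qed.

Lemma normc_real (a : R) : normc a%:C = `|a|.
Proof. by rewrite /normc /= expr0n addr0 sqrtr_sqr. Qed.

Lemma vnorm2_ge0 n (x : 'cV[C]_n) : 0 <= vnorm2 x.
Proof. exact: sqrtr_ge0. Qed.

Lemma sqr_vnorm2 n (x : 'cV[C]_n) : vnorm2 x ^+ 2 = \sum_i normc (x i 0) ^+ 2.
Proof. by rewrite sqr_sqrtr // sumr_ge0 // => i _; exact: sqr_ge0. Qed.

Lemma sqr_vnorm2_dot n (x : 'cV[C]_n) : (vnorm2 x ^+ 2)%:C = (x ^t* *m x) 0 0.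
Proof.
rewrite sqr_vnorm2 rmorph_sum mxE; apply: eq_bigr => i _.
by rewrite rmorphXn /= normc_normr !mxE normCKC.
Qed.

Lemma sqr_vnorm2_Re n (x : 'cV[C]_n) : vnorm2 x ^+ 2 = complex.Re ((x ^t* *m x) 0 0).
Proof. by rewrite -sqr_vnorm2_dot. Qed.

Lemma vnorm2_eq0 n (x : 'cV[C]_n) : (vnorm2 x == 0) = (x == 0).
Proof.
rewrite -sqrf_eq0 sqr_vnorm2 psumr_eq0 => [|i _]; last exact: sqr_ge0.
apply/allP/eqP => [x0|-> i _]; last by rewrite /= mxE Normc.normc0 expr0n.
apply/colP => i; have := x0 i (mem_index_enum i); rewrite sqrf_eq0 mxE => /eqP.
exact: Normc.eq0_normc.
Qed.

Lemma vnorm2_gt0 n (x : 'cV[C]_n) : (0 < vnorm2 x) = (x != 0).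
Proof. by rewrite lt_neqAle vnorm2_ge0 andbT eq_sym vnorm2_eq0. Qed.

Lemma vnorm2Z n (a : C) (x : 'cV[C]_n) : vnorm2 (a *: x) = normc a * vnorm2 x.
Proof.
apply/eqP; rewrite -(@eqrXn2 _ 2) ?mulr_ge0 ?vnorm2_ge0 ?normc_ge0 //; apply/eqP.
rewrite exprMn !sqr_vnorm2 mulr_sumr; apply: eq_bigr => i _.
by rewrite mxE Normc.normcM exprMn.
Qed.

Lemma vnorm2N n (x : 'cV[C]_n) : vnorm2 (- x) = vnorm2 x.
Proof. by rewrite -scaleN1r vnorm2Z normc_opp [normc 1]Normc.normc1 mul1r. Qed.

Lemma normc_entry_le n (x : 'cV[C]_n) i : normc (x i 0) <= vnorm2 x.
Proof.
rewrite -(@ler_pXn2r _ 2) ?nnegrE ?vnorm2_ge0 ?normc_ge0 // sqr_vnorm2.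
by rewrite (bigD1 i) //= lerDl sumr_ge0 // => j _; exact: sqr_ge0.
Qed.

Lemma normc_sum_le (I : Type) (s : seq I) (P : pred I) (f : I -> C) :
  normc (\sum_(i <- s | P i) f i) <= \sum_(i <- s | P i) normc (f i).
Proof. by rewrite -lecR normc_normr rmorph_sum /=; exact: ler_norm_sum. Qed.

Lemma normc_form_le p q (H : 'M[C]_(p, q)) (c : R) (x : 'cV[C]_p) (y : 'cV[C]_q) :
    (forall i j, normc (H i j) <= c) ->
  normc ((x ^t* *m H *m y) 0 0) <= c * (p * q)%:R * (vnorm2 x * vnorm2 y).
Proof.
move=> Hc; rewrite mxE; apply: le_trans (normc_sum_le _ _ _) _.
have -> : c * (p * q)%:R * (vnorm2 x * vnorm2 y) =
    \sum_(j < q) \sum_(i < p) vnorm2 x * c * vnorm2 y.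
  rewrite !sumr_const !card_ord -mulrnA -[RHS]mulr_natr; ring.
apply: ler_sum => j _; rewrite Normc.normcM mxE.
apply: (@le_trans _ _ ((\sum_(i < p) vnorm2 x * c) * vnorm2 y)); last by rewrite mulr_suml.
apply: ler_pM; rewrite ?normc_ge0 ?normc_entry_le //.
apply: le_trans (normc_sum_le _ _ _) _; apply: ler_sum => i _.
rewrite Normc.normcM; apply: ler_pM; rewrite ?normc_ge0 //.
apply: le_trans (normc_entry_le x i); rewrite !mxE -lecR !normc_normr norm_conjC //.
Qed.

Lemma mxnorm2_bound p q (M : 'M[C]_(p, q)) (x : 'cV[C]_q) :
  vnorm2 (M *m x) <= mxnorm2 M * vnorm2 x.
Proof.
have [->|x0] := eqVneq x 0.
  have v0 k : vnorm2 (0 : 'cV[C]_k) = 0 by apply/eqP; rewrite vnorm2_eq0.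
  by rewrite mulmx0 !v0 mulr0.
have nx : 0 < vnorm2 x by rewrite vnorm2_gt0.
rewrite -ler_pdivrMr //.
have nV : normc (((vnorm2 x)^-1)%:C) = (vnorm2 x)^-1.
  by rewrite normc_real ger0_norm // invr_ge0 ltW.
have -> : vnorm2 (M *m x) / vnorm2 x = vnorm2 (M *m (((vnorm2 x)^-1)%:C *: x)).
  by rewrite -scalemxAr vnorm2Z nV mulrC.
apply: ub_le_sup; first by case: (mxnorm2_has_sup M).
by exists (((vnorm2 x)^-1)%:C *: x) => //=; rewrite vnorm2Z nV mulVf // gt_eqF.
Qed.

Lemma mxnorm2_le p q (M : 'M[C]_(p, q)) (c : R) :
  (forall x, vnorm2 (M *m x) <= c * vnorm2 x) -> 0 <= c -> mxnorm2 M <= c.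
Proof.
move=> Mc c0; apply: ge_sup; first by case: (mxnorm2_has_sup M).
move=> _ [x /= x1 <-]; apply: le_trans (Mc x) _.
by rewrite -[leRHS]mulr1 ler_wpM2l.
Qed.

Lemma vnorm2_vec n r (X : 'M[C]_(n, r)) :
  vnorm2 (vec X) ^+ 2 = \sum_j vnorm2 (col j X) ^+ 2.
Proof.
rewrite sqr_vnorm2 (reindex (@mxtens_index r n)) /=; last first.
  by exists (@mxtens_unindex r n) => ? _; rewrite (mxtens_indexK, mxtens_unindexK).
transitivity (\sum_(j < r) \sum_(i < n) normc (X i j) ^+ 2).
  rewrite pair_bigA /=; apply: eq_bigr => -[j i] _ /=.
  by rewrite !mxE mxtens_indexK.
by apply: eq_bigr => j _; rewrite sqr_vnorm2; apply: eq_bigr => i _; rewrite mxE.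
Qed.

Lemma vnorm2_vec_mul p n r (M : 'M[C]_(p, n)) (X : 'M[C]_(n, r)) :
  vnorm2 (vec (M *m X)) <= mxnorm2 M * vnorm2 (vec X).
Proof.
have M0 : 0 <= mxnorm2 M.
  apply: le_trans (vnorm2_ge0 (M *m (0 : 'cV_n))) _.
  apply: ub_le_sup; first by case: (mxnorm2_has_sup M).
  exists 0 => //=; rewrite (_ : vnorm2 _ = 0) ?ler01 //.
  by apply/eqP; rewrite vnorm2_eq0.
rewrite -(@ler_pXn2r _ 2) ?nnegrE ?mulr_ge0 ?vnorm2_ge0 // exprMn !vnorm2_vec mulr_sumr.
apply: ler_sum => j _; rewrite -exprMn ler_pXn2r ?nnegrE ?mulr_ge0 ?vnorm2_ge0 //.
by rewrite colE -mulmxA -colE mxnorm2_bound.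
Qed.

End VectorNorm.

(** * Singular values *)

Lemma count_lt_sorted_nth (R : realType) (ss : seq R) k :
  sorted <=%R ss -> (count (fun x => (x < ss`_k)%R) ss <= k)%N.
Proof.
move=> ss_sorted; rewrite -{2}(cat_take_drop k ss) count_cat -[leqRHS]addn0.
apply: leq_add; first by rewrite (leq_trans (count_size _ _)) // size_take_min geq_minl.
rewrite leqn0 -[_ == _]negbK -lt0n -has_count; apply/hasPn => x /(nthP 0)[j].
rewrite size_drop nth_drop => jlt <-; rewrite -leNgt.
apply: (sorted_leq_nth (@le_trans _ R) (@lexx _ R)) => //; last exact: leq_addr.
  by rewrite inE; apply: leq_ltn_trans (leq_addr j k) _; rewrite -ltn_subRL.
by rewrite inE -ltn_subRL.
Qed.

Lemma count_gt_sorted_nth (R : realType) (ss : seq R) k :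
  sorted <=%R ss -> (k < size ss)%N ->
  (count (fun x => (ss`_k < x)%R) ss <= size ss - k.+1)%N.
Proof.
move=> ss_sorted ks; rewrite -{2}(cat_take_drop k.+1 ss) count_cat -[leqRHS]add0n.
apply: leq_add; last by rewrite (leq_trans (count_size _ _)) // size_drop.
rewrite leqn0 -[_ == _]negbK -lt0n -has_count; apply/hasPn => x /(nthP 0)[j].
rewrite size_take_min leq_min => /andP[jk js]; rewrite nth_take // => <-; rewrite -leNgt.
exact: (sorted_leq_nth (@le_trans _ R) (@lexx _ R)).
Qed.

Section SingularValues.
Variable R : realType.
Local Notation C := R[i].
Local Notation normc := Normc.normc.

Lemma mulmx_kernel_neq0 (F : fieldType) q N (B : 'M[F]_(q, N)) :
  (q < N)%N -> exists2 w : 'cV[F]_N, w != 0 & B *m w = 0.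
Proof.
move=> ltqN; have : kermx B^T != 0.
  rewrite -mxrank_eq0 mxrank_ker -lt0n subn_gt0.
  by apply: leq_ltn_trans ltqN; rewrite mxrank_tr rank_leq_row.
case/rowV0Pn=> v /sub_kermxP vB v0; exists v^T; first by rewrite -trmx0 (inj_eq trmx_inj).
by rewrite -[B]trmxK -trmx_mul vB trmx0.
Qed.

(** [W *m x] lists the coordinates of [x] in an orthonormal eigenbasis of M^* M, and [s] lists the
    singular values in the order of that basis, before sorting. *)
Lemma singular_basis N (M : 'M[C]_N) : exists (W : 'M[C]_N) (s : 'I_N -> R),
  [/\ W \is unitarymx,
      M ^t* *m M = W ^t* *m diag_mx (\row_i ((s i) ^+ 2)%:C) *m W,
      forall i, 0 <= s i
    & singular_values M = sort <=%R [seq s i | i <- enum 'I_N]].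
Proof.
set G := M ^t* *m M; pose s i := Num.sqrt (complex.Re (spectral_diag G 0 i)).
exists (spectralmx G), s; split=> [||i|//].
- exact: spectral_unitarymx.
- have /orthomx_spectralP GE : G \is normalmx := gram_normal M.
  rewrite [LHS]GE (invmx_unitary (spectral_unitarymx G)); congr (_ *m diag_mx _ *m _).
  apply/rowP => i; rewrite mxE /s; have := gram_spectral_ge0 M i; rewrite -/G.
  by case: (spectral_diag G 0 i) => a b; rewrite lecE /= => /andP[/eqP -> a0]; rewrite sqr_sqrtr.
- exact: sqrtr_ge0.
Qed.

Lemma vnorm2_unitary N (W : 'M[C]_N) (x : 'cV[C]_N) :
  W \is unitarymx -> vnorm2 (W *m x) = vnorm2 x.
Proof.
move=> Wu; apply/eqP; rewrite -(@eqrXn2 _ 2) ?vnorm2_ge0 //; apply/eqP.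
rewrite !sqr_vnorm2_Re trmx_mul map_mxM mulmxA -(mulmxA _ _ W).
by rewrite -(invmx_unitary Wu) mulVmx ?mulmx1 // unitarymx_unit.
Qed.

Lemma sqr_vnorm2_mul_diag N (M W : 'M[C]_N) (s : 'I_N -> R) (x : 'cV[C]_N) :
    M ^t* *m M = W ^t* *m diag_mx (\row_i ((s i) ^+ 2)%:C) *m W ->
  vnorm2 (M *m x) ^+ 2 = \sum_i s i ^+ 2 * normc ((W *m x) i 0) ^+ 2.
Proof.
move=> ME; rewrite sqr_vnorm2_Re trmx_mul map_mxM mulmxA -(mulmxA _ _ M) ME.
rewrite !mulmxA -map_mxM -trmx_mul -(mulmxA _ W) mul_mx_diag mxE raddf_sum.
apply: eq_bigr => i _; rewrite !mxE /= mulrAC.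
set z := (\sum_j _); case: z => a b; rewrite /normc /= sqr_sqrtr ?addr_ge0 ?sqr_ge0 //.
by simpc; rewrite /=; ring.
Qed.

Lemma count_map_enum N (s : 'I_N -> R) (p : pred R) :
  count p (sort <=%R [seq s i | i <- enum 'I_N]) = #|[pred i | p (s i)]|.
Proof.
rewrite (permP (permEl (perm_sort _ _))) count_map cardE -size_filter.
by rewrite /enum_mem size_filter filter_predT // size_filter.
Qed.
End SingularValues.

(** * Courant-Fischer bounds, with subspaces given as kernels *)

Section CourantFischer.
Variable R : realType.
Local Notation C := R[i].
Local Notation normc := Normc.normc.
Variables (N : nat) (M : 'M[C]_N).

(** The kernel of the selected rows is the orthogonal complement of the corresponding eigenvectors,
    so spans of singular vectors are handled as kernels. *)
Lemma rowsub_mul_eq0 (W : 'M[C]_N) (p : pred 'I_N) (w : 'cV[C]_N) i :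
  rowsub (@enum_val _ p) W *m w = 0 -> p i -> (W *m w) i 0 = 0.
Proof.
move=> Ww pi; have /colP/(_ (enum_rank_in pi i)) := Ww.
rewrite mul_rowsub_mx mxE enum_rankK_in; last exact: pi.
by move=> ->; rewrite mxE.
Qed.

Lemma size_singular_values : size (singular_values M) = N.
Proof. by rewrite size_sort size_map size_enum_ord. Qed.

Lemma sorted_singular_values : sorted <=%R (singular_values M).
Proof. by apply: sort_sorted; exact: le_total. Qed.

Lemma sigma_min_ge0 k : (0 < k <= N)%N -> 0 <= sigma_min k M.
Proof.
case/andP=> k0 kN; have [W [s [_ _ s0 sE]]] := singular_basis M.
have : sigma_min k M \in singular_values M by rewrite mem_nth // size_singular_values prednK.
by rewrite sE mem_sort => /mapP[i _ ->].
Qed.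

(** The test subspace is orthogonal to the singular vectors with value below sigma_k. These number
    at most k - 1, and [M] stretches every vector of the subspace by at least sigma_k. *)
Lemma sigma_min_le k (c : R) : (0 < k <= N)%N ->
    (forall q (B : 'M[C]_(q, N)), (q < k)%N ->
      exists w, [/\ w != 0, B *m w = 0 & vnorm2 (M *m w) <= c * vnorm2 w]) ->
  sigma_min k M <= c.
Proof.
case/andP=> k0 kN Bw; have [W [s [Wu ME s0 sE]]] := singular_basis M.
have [|w [w0 ww Mw]] := Bw _ (rowsub (@enum_val _ [pred i | s i < sigma_min k M]) W).
  have := count_lt_sorted_nth k.-1 sorted_singular_values.
  by rewrite sE count_map_enum -ltnS prednK // -sE.
have nw : 0 < vnorm2 w by rewrite vnorm2_gt0.
rewrite -(ler_pM2r nw); apply: le_trans Mw.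
have sig0 : 0 <= sigma_min k M by rewrite sigma_min_ge0 // k0.
rewrite -(@ler_pXn2r _ 2) ?nnegrE ?mulr_ge0 ?vnorm2_ge0 // exprMn.
rewrite (sqr_vnorm2_mul_diag _ ME) -(vnorm2_unitary w Wu) sqr_vnorm2 mulr_sumr.
apply: ler_sum => i _; have [si|si] := ltP (s i) (sigma_min k M).
  by rewrite (rowsub_mul_eq0 ww) // Normc.normc0 expr0n !mulr0.
by rewrite ler_wpM2r ?sqr_ge0 // ler_pXn2r ?nnegrE.
Qed.

(** At most N - k singular values exceed sigma_k, so the kernel of [B] contains some w != 0
    orthogonal to their singular vectors, by q + (N - k) < N. Such a w is stretched by at most
    sigma_k. *)
Lemma sigma_min_gt k (c : R) q (B : 'M[C]_(q, N)) : (0 < k <= N)%N -> (q < k)%N ->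
    (forall w, w != 0 -> B *m w = 0 -> c * vnorm2 w < vnorm2 (M *m w)) ->
  c < sigma_min k M.
Proof.
case/andP=> k0 kN qk Bw; have [W [s [Wu ME s0 sE]]] := singular_basis M.
have [|w w0] := mulmx_kernel_neq0
    (col_mx B (rowsub (@enum_val _ [pred i | sigma_min k M < s i]) W)).
  have := @count_gt_sorted_nth _ _ k.-1 sorted_singular_values.
  rewrite size_singular_values prednK // => /(_ kN).
  rewrite {2}sE count_map_enum => cle.
  apply: leq_ltn_trans (leq_add (leqnn q) cle) _.
  by rewrite addnC -ltn_subRL subKn.
rewrite mul_col_mx => /eqP; rewrite col_mx_eq0 => /andP[/eqP Bw0 /eqP ww].
have nw : 0 < vnorm2 w by rewrite vnorm2_gt0.
rewrite -(ltr_pM2r nw); apply: lt_le_trans (Bw w w0 Bw0) _.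
have sig0 : 0 <= sigma_min k M by rewrite sigma_min_ge0 // k0.
rewrite -(@ler_pXn2r _ 2) ?nnegrE ?mulr_ge0 ?vnorm2_ge0 // exprMn.
rewrite (sqr_vnorm2_mul_diag _ ME) -(vnorm2_unitary w Wu) [X in _ <= _ * X]sqr_vnorm2 mulr_sumr.
apply: ler_sum => i _; have [si|si] := ltP (sigma_min k M) (s i).
  by rewrite (rowsub_mul_eq0 ww) // Normc.normc0 expr0n !mulr0.
by rewrite ler_wpM2r ?sqr_ge0 // ler_pXn2r ?nnegrE.
Qed.

End CourantFischer.

(** * Perturbation of a simple singular value *)

Section Perturbation.
Variable R : realType.
Local Notation C := R[i].
Local Notation normc := Normc.normc.

(** Meant for [a] the size of the component along the simple singular vector, [e] the size of the
    rest, [g] the spectral gap, [p] the first-order gain and [b] an error bound. For small t the gap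
    absorbs the cross term, by completing a square. *)
Lemma quadratic_form_pos (g p b : R) : 0 < g -> 0 < p -> 0 <= b ->
  exists t, [/\ 0 < t, t <= 1 & forall a e, 0 <= a -> 0 <= e -> 0 < a \/ 0 < e ->
    0 < g * e ^+ 2 + 2 * t * (a ^+ 2 * (p - t * b) - 4 * b * a * e - 2 * b * e ^+ 2)].
Proof.
(* The witness is t = 1/k; the summands of [k] secure t <= 1, 2bt <= p, 8bt <= g and 32b^2 t <
   gp. *)
move=> g0 p0 b0; pose k := 1 + 2 * b / p + 8 * b / g + 32 * b ^+ 2 / (g * p).
have h1 : 0 <= 2 * b / p by rewrite divr_ge0 ?mulr_ge0 // ltW.
have h2 : 0 <= 8 * b / g by rewrite divr_ge0 ?mulr_ge0 // ltW.
have h3 : 0 <= 32 * b ^+ 2 / (g * p) by rewrite divr_ge0 ?mulr_ge0 ?sqr_ge0 // ltW // mulr_gt0.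
have k0 : 0 < k by rewrite /k; lra.
have bnd (c h : R) : 0 < h -> c / h <= k -> c * k^-1 <= h.
  by move=> h0; rewrite !ler_pdivrMr // mulrC.
have t1 : k^-1 <= 1 by rewrite invf_le1 // /k; lra.
have tb1 : 2 * b * k^-1 <= p by apply: bnd => //; rewrite /k; lra.
have tb2 : 8 * b * k^-1 <= g by apply: bnd => //; rewrite /k; lra.
have tb3 : 32 * b ^+ 2 * k^-1 < g * p.
  rewrite ltr_pdivrMr // -ltr_pdivrMl ?mulr_gt0 // mulrC /k; lra.
have t0 : 0 < k^-1 by rewrite invr_gt0.
move: (k^-1) t0 t1 tb1 tb2 tb3 => t t0 t1 tb1 tb2 tb3 {h1 h2 h3}.
exists t; split=> // a e a0 e0 ae.
have main : 0 < g / 2 * e ^+ 2 + t * p * a ^+ 2 - 8 * t * b * a * e.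
  have tp : 0 < t * p by rewrite mulr_gt0.
  rewrite -(pmulr_rgt0 _ tp).
  have -> : t * p * (g / 2 * e ^+ 2 + t * p * a ^+ 2 - 8 * t * b * a * e) =
    (t * p * a - 4 * t * b * e) ^+ 2 + t * e ^+ 2 * (g * p - 32 * b ^+ 2 * t) / 2 by field.
  have [e_eq|e_gt] : e = 0 \/ 0 < e by move: e0; rewrite le_eqVlt => /orP[/eqP <-|]; [left|right].
    case: ae => [a_gt|]; last by rewrite e_eq ltxx.
    by rewrite e_eq expr0n !mulr0 !mul0r addr0 subr0 exprn_gt0 // mulr_gt0.
  apply: ltr_wpDl; first exact: sqr_ge0.
  by rewrite divr_gt0 // mulr_gt0 ?subr_gt0 // mulr_gt0 ?exprn_gt0.
have e2 := sqr_ge0 e; have a2 := sqr_ge0 a.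
have h1 : 0 <= e ^+ 2 * (g - 8 * b * t) by rewrite mulr_ge0 // subr_ge0.
have h2 : 0 <= a ^+ 2 * (t * (p - 2 * b * t)) by rewrite !mulr_ge0 ?subr_ge0 // ltW.
have -> : g * e ^+ 2 + 2 * t * (a ^+ 2 * (p - t * b) - 4 * b * a * e - 2 * b * e ^+ 2) =
  g / 2 * e ^+ 2 + t * p * a ^+ 2 - 8 * t * b * a * e + e ^+ 2 * (g - 8 * b * t) / 2
  + a ^+ 2 * (t * (p - 2 * b * t)) by field.
lra.
Qed.

(** A family bounded in this sense uniformly for 0 <= t <= 1 serves as the O(1) coefficient of a
    second-order term. *)
Definition mxbounded p q (c : R) (M : 'M[C]_(p, q)) := forall i j, normc (M i j) <= c.

Lemma mxbounded_exists p q (M : 'M[C]_(p, q)) : exists c, mxbounded c M.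
Proof.
exists (\sum_i \sum_j normc (M i j)) => i j.
rewrite (bigD1 i) //= (bigD1 j) //= -addrA lerDl addr_ge0 ?sumr_ge0 // => *;
  rewrite ?sumr_ge0 // => *; exact: normc_ge0.
Qed.

Lemma mxbounded_mul p q r (a b : R) (M : 'M[C]_(p, q)) (M' : 'M[C]_(q, r)) :
  mxbounded a M -> mxbounded b M' -> mxbounded (\sum_(k < q) a * b) (M *m M').
Proof.
move=> Ma Mb i j; rewrite mxE; apply: le_trans (normc_sum_le _ _ _) _.
by apply: ler_sum => k _; rewrite Normc.normcM ler_pM ?normc_ge0.
Qed.

Lemma mxboundedD p q (a b : R) (M M' : 'M[C]_(p, q)) :
  mxbounded a M -> mxbounded b M' -> mxbounded (a + b) (M + M').
Proof.
by move=> Ma Mb i j; rewrite mxE; apply: le_trans (le_normcD _ _) _; rewrite lerD.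
Qed.

Lemma sqr_vnorm2D_ge N (x y : 'cV[C]_N) (t : R) :
  vnorm2 x ^+ 2 + 2 * t * complex.Re ((x ^t* *m y) 0 0) <= vnorm2 (x + t%:C *: y) ^+ 2.
Proof.
have -> : vnorm2 (x + t%:C *: y) ^+ 2 =
    vnorm2 x ^+ 2 + 2 * t * complex.Re ((x ^t* *m y) 0 0) + t ^+ 2 * vnorm2 y ^+ 2.
  rewrite !sqr_vnorm2 mulr_sumr mxE raddf_sum mulr_sumr -!big_split /=.
  apply: eq_bigr => i _; rewrite !mxE.
  case: (x i 0) (y i 0) => [x1 x2] [y1 y2]; rewrite /normc /=.
  by rewrite !sqr_sqrtr ?addr_ge0 ?sqr_ge0 //; ring.
by rewrite lerDl mulr_ge0 ?sqr_ge0.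
Qed.

Lemma Re_ge_normc (z : C) : - normc z <= complex.Re z.
Proof.
case: z => a b /=; rewrite lerNl; apply: le_trans (ler_norm _) _.
by rewrite normrN -sqrtr_sqr ler_sqrt ?addr_ge0 ?sqr_ge0 // lerDl sqr_ge0.
Qed.

Lemma positive_gap N (s : 'I_N -> R) (x : R) : 0 <= x ->
  exists2 g, 0 < g & forall i, x < s i -> g <= s i ^+ 2 - x ^+ 2.
Proof.
move=> x0; have gap i : x < s i -> 0 < s i ^+ 2 - x ^+ 2.
  by move=> xs; rewrite subr_gt0 ltr_pXn2r // nnegrE // (le_trans x0) // ltW.
(* The default 1 covers the case that no value exceeds [x]. *)
exists (\big[Num.min/1]_(i | x < s i) (s i ^+ 2 - x ^+ 2)).
  by apply: (big_ind (fun y => 0 < y)) => // y z y0 z0; rewrite lt_min y0.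
by move=> i xs; exact: (bigmin_le_cond).
Qed.

End Perturbation.

Lemma form_axpy (K : numClosedFieldType) N (H : 'M[K]_N) (a : K) (x y : 'cV[K]_N) :
  (a *: x + y) ^t* *m H *m (a *: x + y) =
    (Num.conj a * a) *: (x ^t* *m H *m x) + Num.conj a *: (x ^t* *m H *m y)
    + a *: (y ^t* *m H *m x) + y ^t* *m H *m y.
Proof.
have -> : (a *: x + y) ^t* = Num.conj a *: x ^t* + y ^t*.
  by apply/matrixP => i j; rewrite !mxE rmorphD rmorphM.
by rewrite !mulmxDl !mulmxDr -!scalemxAl -!scalemxAr !scalerA addrA.
Qed.

Lemma cross_terms_le (F : realFieldType) (a b e p z1 z2 z3 z4 : F) :
    a ^+ 2 * p <= z1 -> - (a * (2 * b * e)) <= z2 -> - (a * (2 * b * e)) <= z3 ->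
    - (2 * b * (e * e)) <= z4 ->
  a ^+ 2 * p - 4 * b * a * e - 2 * b * e ^+ 2 <= z1 + z2 + z3 + z4.
Proof. lra. Qed.

Section SigmaMinPerturbation.
Variable R : realType.
Local Notation C := R[i].
Local Notation normc := Normc.normc.

Lemma conjC_real (a : R) : Num.conj a%:C = a%:C.
Proof. by apply/eqP; rewrite eq_complex /= oppr0 !eqxx. Qed.

Lemma Re_realM (a : R) (z : C) : complex.Re (a%:C * z) = a * complex.Re z.
Proof. by case: z => b c; simpc. Qed.

Lemma normc_conj (z : C) : normc (Num.conj z) = normc z.
Proof. by case: z => a b; rewrite /normc /= sqrrN. Qed.

Lemma Re_addmx p q (A B : 'M[C]_(p, q)) i j :
  complex.Re ((A + B) i j) = complex.Re (A i j) + complex.Re (B i j).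
Proof. by rewrite mxE; case: (A i j); case: (B i j). Qed.

Lemma Re_scalemx p q (a : R) (A : 'M[C]_(p, q)) i j :
  complex.Re ((a%:C *: A) i j) = a * complex.Re (A i j).
Proof. by rewrite mxE Re_realM. Qed.

Lemma Re_axpy_ge p q (a t b : R) (A B : 'M[C]_(p, q)) i j : 0 <= t -> normc (B i j) <= b ->
  a * complex.Re (A i j) - t * b <= complex.Re ((a%:C *: A + t%:C *: B) i j).
Proof.
move=> t0 Bb; rewrite Re_addmx !Re_scalemx lerD2l -mulrN ler_wpM2l //.
by apply: le_trans (Re_ge_normc _); rewrite lerN2.
Qed.

(* The subspace of right singular vectors for singular values at least sigma_k
   stays a witness for the max-min characterisation: to first order the norm
   increases along V, and the other directions have a spectral gap. *)
Lemma sigma_min_perturb N k (Q D : 'M[C]_N) (E : R -> 'M[C]_N) (c x : R) (U V : 'cV[C]_N) :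
    (0 < k <= N)%N -> sigma_min k Q = x -> singular_value_mult Q x = 1%N ->
    0 < x -> vnorm2 V = 1 -> Q *m V = x%:C *: U -> U ^t* *m Q = x%:C *: V ^t* ->
    (forall t, 0 <= t <= 1 -> mxbounded c (E t)) ->
    0 < complex.Re ((U ^t* *m D *m V) 0 0) ->
  exists t, [/\ 0 < t, t <= 1 & x < sigma_min k (Q + t%:C *: (D + t%:C *: E t))].
Proof.
move=> kN sigx multx x0 nV QV UQ Ec dpos; set d := complex.Re _ in dpos.
have [W [s [Wu QE s0 sE]]] := singular_basis Q.
have [i0 s_x] : exists i0, forall i, (s i == x) = (i == i0).
  move: multx; rewrite /singular_value_mult sE count_map_enum => /eqP/card1P[i0 i0E].
  by exists i0 => i; have := i0E i; rewrite !inE.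
have [g g0 gap] := positive_gap s (ltW x0).
pose z := W *m V.
(* [V] is an eigenvector of Q^* Q for x^2, and [i0] is the only index with that eigenvalue. *)
have z0 i : i != i0 -> z i 0 = 0.
  move=> ii0; have QQV : Q ^t* *m Q *m V = (x ^+ 2)%:C *: V.
    rewrite -mulmxA QV -scalemxAr.
    have -> : Q ^t* *m U = x%:C *: V.
      have := congr1 (fun X => X ^t*) UQ; rewrite trmx_mul map_mxM trmxCK => ->.
      by rewrite linearZ /= map_mxZ trmxCK /= conjC_real.
    by rewrite scalerA -rmorphM.
  have : W *m (Q ^t* *m Q *m V) = (x ^+ 2)%:C *: z by rewrite QQV scalemxAr.
  rewrite QE -(invmx_unitary Wu) !mulmxA mulmxV ?unitarymx_unit // mul1mx -mulmxA -/z.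
  rewrite mul_diag_mx => /colP/(_ i); rewrite mxE [RHS]mxE [X in X * _]mxE.
  move/eqP; rewrite -subr_eq0 -mulrBl mulf_eq0 subr_eq0 (inj_eq (@complexI R)).
  by rewrite eqrXn2 ?s0 ?ltW // s_x (negPf ii0) => /eqP.
have zi0 : z i0 0 != 0.
  apply/negP => /eqP zi0; have : vnorm2 z = 0.
    apply/eqP; rewrite vnorm2_eq0; apply/eqP/colP => j; rewrite [RHS]mxE.
    by have [->//|/z0] := eqVneq j i0.
  by rewrite vnorm2_unitary // nV => /eqP; rewrite oner_eq0.
have [cD HD] := mxbounded_exists (Q ^t* *m D).
have [cQ HQ] := mxbounded_exists (Q ^t*).
have HE t (t01 : 0 <= t <= 1) := mxbounded_mul HQ (Ec t t01).
(* One constant bounds the forms Q^* D and Q^* E(t) for all t in [0, 1]; the factor N^2 comes from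
   [normc_form_le]. *)
pose b := (Num.max 0 (Num.max cD (\sum_(l < N) cQ * c))) * (N * N)%:R.
have b0 : 0 <= b by rewrite mulr_ge0 // le_max lexx.
have formD (y w : 'cV_N) :
    normc ((y ^t* *m (Q ^t* *m D) *m w) 0 0) <= b * (vnorm2 y * vnorm2 w).
  by apply: normc_form_le => i j; rewrite !le_max HD orbT.
have formE t (y w : 'cV_N) : 0 <= t <= 1 ->
    normc ((y ^t* *m (Q ^t* *m E t) *m w) 0 0) <= b * (vnorm2 y * vnorm2 w).
  by move=> t01; apply: normc_form_le => i j; rewrite !le_max HE ?orbT.
have [t [t0 t1 t_pos]] := quadratic_form_pos g0 (mulr_gt0 x0 dpos) b0.
have t01 : 0 <= t <= 1 by rewrite ltW.
exists t; split=> //.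
apply: (@sigma_min_gt _ _ _ k _ _ (rowsub (@enum_val _ [pred i | s i < x]) W)) => //.
  case/andP: kN => k0 kN.
  have := count_lt_sorted_nth k.-1 (sorted_singular_values Q).
  by rewrite sE count_map_enum -ltnS prednK // -sE -/(sigma_min k Q) sigx.
move=> w w0 Ww; have {}Ww i : s i < x -> (W *m w) i 0 = 0 by exact: rowsub_mul_eq0 Ww.
(* [al] cancels coordinate [i0], so [y] is supported on the indices with s_i > x, where the gap
   applies. *)
pose al := (W *m w) i0 0 / z i0 0; pose y := w - al *: V.
have Wy i : (W *m y) i 0 = if i == i0 then 0 else (W *m w) i 0.
  rewrite mulmxBr -scalemxAr -/z mxE [X in _ + X]mxE [X in - X]mxE.
  have [->|/z0 ->] := eqVneq; last by rewrite mulr0 subr0.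
  by rewrite divfK // subrr.
have wE : w = al *: V + y by rewrite addrC subrK.
clearbody y.
have gap_le : x ^+ 2 * vnorm2 w ^+ 2 + g * vnorm2 y ^+ 2 <= vnorm2 (Q *m w) ^+ 2.
  rewrite (sqr_vnorm2_mul_diag _ QE) -(vnorm2_unitary w Wu) -(vnorm2_unitary y Wu).
  rewrite !sqr_vnorm2 !mulr_sumr -big_split /=; apply: ler_sum => i _.
  rewrite Wy; have [ii0|ii0] := eqVneq i i0.
    have /eqP -> : s i == x by rewrite s_x ii0.
    by rewrite [normc 0]Normc.normc0 expr0n mulr0 addr0.
  have [si|xs] := ltP (s i) x.
    by rewrite Ww // [normc 0]Normc.normc0 expr0n !mulr0 addr0.
  rewrite -mulrDl ler_wpM2r ?sqr_ge0 // addrC -lerBrDr gap //.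
  by rewrite lt_neqAle xs andbT eq_sym s_x.
have ny : 0 <= vnorm2 y := vnorm2_ge0 y.
have na : 0 <= normc al := normc_ge0 al.
have aypos : 0 < normc al \/ 0 < vnorm2 y.
  have [y0|y0] := eqVneq y 0; last by right; rewrite vnorm2_gt0.
  left; rewrite lt_neqAle normc_ge0 andbT eq_sym; apply/eqP => /Normc.eq0_normc al0.
  by move: w0; rewrite wE y0 al0 scale0r addr0 eqxx.
have {t_pos} := t_pos _ _ na ny aypos.
set H := Q ^t* *m (D + t%:C *: E t).
have HE' (u v : 'cV_N) : (u ^t* *m H *m v) 0 0 =
    (u ^t* *m (Q ^t* *m D) *m v) 0 0 + t%:C * (u ^t* *m (Q ^t* *m E t) *m v) 0 0.
  rewrite /H mulmxDr -scalemxAr mulmxDr -scalemxAr mulmxDl -scalemxAl.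
  by rewrite mxE [X in _ + X]mxE.
have formH (u v : 'cV_N) : normc ((u ^t* *m H *m v) 0 0) <= 2 * b * (vnorm2 u * vnorm2 v).
  rewrite HE'; apply: le_trans (le_normcD _ _) _; rewrite Normc.normcM normc_real (gtr0_norm t0).
  rewrite -(mulrA 2) mulr_natl mulr2n lerD //.
  exact: le_trans (ler_piMl (normc_ge0 _) t1) (formE t u v t01).
(* As Q V = x U, the form at [V] is x U^* D V up to an error of at most t b. *)
have formVV : x * d - t * b <= complex.Re ((V ^t* *m H *m V) 0 0).
  have -> : V ^t* *m H *m V =
      x%:C *: (U ^t* *m D *m V) + t%:C *: (V ^t* *m (Q ^t* *m E t) *m V).
    have -> : x%:C *: (U ^t* *m D *m V) = V ^t* *m (Q ^t* *m D) *m V.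
      rewrite mulmxA -map_mxM -trmx_mul QV linearZ /= map_mxZ /= conjC_real.
      by rewrite !scalemxAl.
    by rewrite /H mulmxDr -scalemxAr mulmxDr mulmxDl -scalemxAr -scalemxAl.
  by apply: Re_axpy_ge (ltW t0) _; have := formE t V V t01; rewrite nV !mulr1.
have form_w : normc al ^+ 2 * (x * d - t * b) - 4 * b * normc al * vnorm2 y
    - 2 * b * vnorm2 y ^+ 2 <= complex.Re ((w ^t* *m H *m w) 0 0).
  rewrite wE form_axpy !Re_addmx.
  have VV : normc al ^+ 2 * (x * d - t * b) <=
      complex.Re (((Num.conj al * al) *: (V ^t* *m H *m V)) 0 0).
    have -> : Num.conj al * al = (normc al ^+ 2)%:C by rewrite rmorphXn -normCKC.
    by rewrite Re_scalemx ler_wpM2l // sqr_ge0.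
  have Vy : - (normc al * (2 * b * vnorm2 y)) <=
      complex.Re ((Num.conj al *: (V ^t* *m H *m y)) 0 0).
    apply: le_trans (Re_ge_normc _); rewrite lerN2 mxE Normc.normcM normc_conj ler_wpM2l //.
    by have := formH V y; rewrite nV mul1r.
  have yV : - (normc al * (2 * b * vnorm2 y)) <= complex.Re ((al *: (y ^t* *m H *m V)) 0 0).
    apply: le_trans (Re_ge_normc _); rewrite lerN2 mxE Normc.normcM ler_wpM2l //.
    by have := formH y V; rewrite nV mulr1.
  have yy : - (2 * b * (vnorm2 y * vnorm2 y)) <= complex.Re ((y ^t* *m H *m y) 0 0).
    by apply: le_trans (Re_ge_normc _); rewrite lerN2.
  exact: cross_terms_le VV Vy yV yy.
move=> qpos; rewrite -(@ltr_pXn2r _ 2) ?nnegrE ?mulr_ge0 ?vnorm2_ge0 ?ltW // exprMn.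
have -> : (Q + t%:C *: (D + t%:C *: E t)) *m w = Q *m w + t%:C *: ((D + t%:C *: E t) *m w).
  by rewrite mulmxDl scalemxAl.
apply: lt_le_trans (sqr_vnorm2D_ge _ _ _).
rewrite trmx_mul map_mxM mulmxA -(mulmxA _ _ (D + _)) -/H.
have : 2 * t * (normc al ^+ 2 * (x * d - t * b) - 4 * b * normc al * vnorm2 y
    - 2 * b * vnorm2 y ^+ 2) <= 2 * t * complex.Re ((w ^t* *m H *m w) 0 0).
  by rewrite ler_wpM2l // mulr_ge0 // ltW.
lra.
Qed.
End SigmaMinPerturbation.

(** * First-order optimality *)

Lemma mxtrace_mul_delta (F : fieldType) p q (M : 'M[F]_(p, q)) i j :
  \tr (M *m delta_mx j i) = M i j.
Proof.
rewrite mxtrace_mulC /mxtrace (bigD1 j) //= big1 ?addr0 => [|k kj].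
  rewrite mxE (bigD1 i) //= big1 ?addr0 => [|l li]; first by rewrite mxE !eqxx mul1r.
  by rewrite mxE (negPf li) andbF mul0r.
by rewrite mxE big1 // => l _; rewrite mxE (negPf kj) mul0r.
Qed.

Lemma mxtrace_mul_inj (F : fieldType) p q (M M' : 'M[F]_(p, q)) :
  (forall Y, \tr (M *m Y) = \tr (M' *m Y)) -> M = M'.
Proof. by move=> MM'; apply/matrixP => i j; rewrite -!mxtrace_mul_delta MM'. Qed.

(** The derivative of the j-th power at [C] in the direction [E]. *)
Definition powmx_diff (F : fieldType) r (C E : 'M[F]_r) j :=
  \sum_(a < j) C ^+ a *m E *m C ^+ (j - a.+1).

Lemma powmx_diffS (F : fieldType) r (C E : 'M[F]_r) j :
  powmx_diff C E j.+1 = powmx_diff C E j *m C + C ^+ j *m E.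
Proof.
rewrite /powmx_diff big_ord_recr /= subnn expr0 mulmx1 mulmx_suml; congr (_ + _).
by apply: eq_bigr => a _; rewrite subSS -[in LHS]subnSK // exprSr !mulmxA.
Qed.

(** Noncommutative telescoping: the term of index a contributes f(a+1) - f(a), where f(a) = C^(j-a)
    G C^a. *)
Lemma powmx_commutator (F : fieldType) r (C G : 'M[F]_r) j :
  let S := \sum_(a < j) C ^+ (j - a.+1) *m G *m C ^+ a in
  S *m C - C *m S = G *m C ^+ j - C ^+ j *m G.
Proof.
pose f a := C ^+ (j - a) *m G *m C ^+ a.
have powSr k : C ^+ k *m C = C ^+ k.+1 by rewrite exprSr.
have powS k : C *m C ^+ k = C ^+ k.+1 by rewrite exprS.
rewrite /= mulmx_suml mulmx_sumr -sumrB.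
transitivity (\sum_(0 <= a < j) (f a.+1 - f a)); last first.
  by rewrite telescope_sumr // /f subnn subn0 !expr0 mul1mx mulmx1.
rewrite big_mkord; apply: eq_bigr => a _; rewrite /f !mulmxA -(mulmxA _ (C ^+ a)).
by rewrite powSr powS subnSK.
Qed.

Section FirstOrder.
Variable R : realType.
Local Notation C := R[i].
Local Notation normc := Normc.normc.

Lemma vec_dot n r (X Y : 'M[C]_(n, r)) : ((vec X) ^t* *m vec Y) 0 0 = \tr (X ^t* *m Y).
Proof.
rewrite mxE (reindex (@mxtens_index r n)) /=; last first.
  by exists (@mxtens_unindex r n) => ? _; rewrite (mxtens_indexK, mxtens_unindexK).
transitivity (\sum_(j < r) \sum_(i < n) (Num.conj (X i j)) * Y i j).
  rewrite pair_bigA /=; apply: eq_bigr => -[j i] _ /=.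
  by rewrite !mxE mxtens_indexK.
by apply: eq_bigr => j _; rewrite mxE; apply: eq_bigr => i _; rewrite !mxE.
Qed.

Lemma powmx_expansion r (T E : 'M[C]_r) j : exists (P : R -> 'M[C]_r) (c : R),
  (forall t, 0 <= t <= 1 -> mxbounded c (P t)) /\
  (forall t, (T + t%:C *: E) ^+ j = T ^+ j + t%:C *: (powmx_diff T E j + t%:C *: P t)).
Proof.
have [cT HT] := mxbounded_exists T; have [cE HE] := mxbounded_exists E.
elim: j => [|j [P [c [Pc PE]]]].
  exists (fun=> 0), 0; split=> [t _ i k|t]; first by rewrite mxE [normc 0]Normc.normc0.
  by rewrite !expr0 /powmx_diff big_ord0 scaler0 addr0 scaler0 addr0.
have [cS HS] := mxbounded_exists (powmx_diff T E j).
(* The t^2 part of (T^j + t S + t^2 P)(T + t E), where S is the derivative of the j-th power. *)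
exists (fun t => powmx_diff T E j *m E + P t *m T + t%:C *: (P t *m E)).
pose c1 := \sum_(k < r) cS * cE; pose c2 := \sum_(k < r) c * cT; pose c3 := \sum_(k < r) c * cE.
exists (c1 + c2 + c3); split=> t => [t01|].
  apply: mxboundedD; first by apply: mxboundedD; apply: mxbounded_mul => //; exact: Pc.
  move=> i k; rewrite mxE Normc.normcM normc_real; case/andP: (t01) => t0 t1.
  rewrite ger0_norm //; apply: le_trans (ler_piMl (normc_ge0 _) t1) _.
  by apply: mxbounded_mul => //; exact: Pc.
rewrite exprSr PE powmx_diffS.
have -> : (T ^+ j + t%:C *: (powmx_diff T E j + t%:C *: P t)) * (T + t%:C *: E) =
  (T ^+ j + t%:C *: (powmx_diff T E j + t%:C *: P t)) *m (T + t%:C *: E) by [].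
rewrite exprSr -[T ^+ j * T]/(T ^+ j *m T).
rewrite !mulmxDl !mulmxDr -!scalemxAl -!scalemxAr !mulmxDl -!scalemxAl.
move: (T ^+ j *m T) (T ^+ j *m E) (powmx_diff T E j *m T) (powmx_diff T E j *m E) => a1 a2 a3 a4.
move: (P t *m T) (P t *m E) => a5 a6; move: (t%:C) => z.
by apply/matrixP => i k; rewrite !mxE; ring.
Qed.

(** Strictly upper triangular perturbations are absorbed into the parameters, so they are admissible
    variations for the supremum over Gamma. *)
Lemma Cmx_perturb r (mu : r.-tuple C) (Gamma : gammas r) (E : 'M[C]_r) (z : C) :
    (forall k i : 'I_r, (i <= k)%N -> E k i = 0) ->
  Cmx mu [ffun p => Gamma p + z * E (val p).2 (val p).1] = Cmx mu Gamma + z *: E.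
Proof.
move=> Eup; apply/matrixP => k i; rewrite !mxE.
case: insubP => [p ki pE|/=]; first by rewrite ffunE pE.
by rewrite -leqNgt => /Eup ->; rewrite mulr0 addr0.
Qed.

Lemma Qmx_perturb m n r (A : 'I_m.+1 -> 'M[C]_n) (mu : r.-tuple C) (Gamma : gammas r)
    (E : 'M[C]_r) : (forall k i : 'I_r, (i <= k)%N -> E k i = 0) ->
  exists (P : R -> 'M[C]_(r * n)) (c : R),
    (forall t, 0 <= t <= 1 -> mxbounded c (P t)) /\
    (forall t, exists Gt, Qmx A mu Gt = Qmx A mu Gamma
       + t%:C *: (\sum_(j < m.+1) (powmx_diff (Cmx mu Gamma) E j)^T *t A j + t%:C *: P t)).
Proof.
move=> Eup; have [P /choice[c Pc]] := choice (powmx_expansion (Cmx mu Gamma) E).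
have /choice[a Aa] : forall j, exists a, mxbounded a (A j) by move=> j; exact: mxbounded_exists.
exists (fun t => \sum_(j < m.+1) (P j t)^T *t A j), (\sum_(j < m.+1) c j * a j); split=> [t t01|t].
  move=> i k; rewrite summxE; apply: le_trans (normc_sum_le _ _ _) _; apply: ler_sum => j _.
  by rewrite !mxE Normc.normcM ler_pM ?normc_ge0 //; [exact: (Pc j).1|exact: Aa].
exists [ffun p => Gamma p + t%:C * E (val p).2 (val p).1].
rewrite /Qmx (Cmx_perturb _ _ _ Eup) scaler_sumr -big_split scaler_sumr -big_split /=.
apply: eq_bigr => j _; rewrite (Pc j).2.
by apply/matrixP => i k; rewrite !mxE; ring.
Qed.

End FirstOrder.

Section Optimality.
Variable R : realType.
Local Notation C := R[i].
Local Notation normc := Normc.normc.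
Variables (m n r : nat) (A : 'I_m.+1 -> 'M[C]_n) (mu : r.-tuple C) (Gamma : @gammas R r).

(** The left singular vector equation in matrix form, obtained by testing it on an arbitrary [vec Y]
    through the trace pairing. *)
Lemma adjoint_Qmx (U V : 'M[C]_(n, r)) (x : C) :
    (vec U) ^t* *m Qmx A mu Gamma = x *: (vec V) ^t* ->
  \sum_(j < m.+1) Cmx mu Gamma ^+ j *m (U ^t* *m A j) = x *: V ^t*.
Proof.
move=> UQ; apply: mxtrace_mul_inj => Y.
have := congr1 (fun X => (X *m vec Y) 0 0) UQ.
rewrite -mulmxA Qmx_mul_vec vec_dot -scalemxAl mxE vec_dot -mxtraceZ -scalemxAl => <-.
rewrite /mxeval mulmx_suml mulmx_sumr !raddf_sum; apply: eq_bigr => j _.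
by rewrite /= -[in LHS]mulmxA mxtrace_mulC !mulmxA.
Qed.

Lemma gram_eq_of_optimal (x : R) (U V : 'M[C]_(n, r)) :
    (0 < n)%N -> (0 < r)%N -> 0 < x ->
    sigma_min r (Qmx A mu Gamma) = x -> singular_value_mult (Qmx A mu Gamma) x = 1%N ->
    (forall G, sigma_min r (Qmx A mu G) <= x) ->
    vnorm2 (vec V) = 1 -> Qmx A mu Gamma *m vec V = x%:C *: vec U ->
    (vec U) ^t* *m Qmx A mu Gamma = x%:C *: (vec V) ^t* ->
  U ^t* *m U = V ^t* *m V.
Proof.
move=> n0 r0 x0 sigx multx opt nV QV UQ.
set T := Cmx mu Gamma; pose G j := U ^t* *m A j *m V.
(* [S] represents the derivative of U^* Q V with respect to C: in the direction E it equals tr (S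
   E). *)
pose S := \sum_(j < m.+1) \sum_(a < j) T ^+ (j - a.+1) *m G j *m T ^+ a.
have Tup (i j : 'I_r) : (j < i)%N -> T i j = 0.
  by move=> ji; rewrite (Cmx_diag_upper _ _ (ltnW ji)) -val_eqE /= gtn_eqF.
have trS (E : 'M_r) : ((vec U) ^t* *m (\sum_(j < m.+1) (powmx_diff T E j)^T *t A j)
    *m vec V) 0 0 = \tr (S *m E).
  rewrite -mulmxA mulmx_suml.
  under eq_bigr => j _ do rewrite vec_tens.
  rewrite -linear_sum vec_dot mulmx_sumr mulmx_suml !raddf_sum; apply: eq_bigr => j _.
  rewrite /powmx_diff mulmx_sumr mulmx_sumr mulmx_suml !raddf_sum; apply: eq_bigr => a _.
  by rewrite !mulmxA /= mxtrace_mulC !mulmxA.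
(* First-order optimality: tr (S E) = 0 for every strictly upper triangular E. *)
have Sup (i k : 'I_r) : (k < i)%N -> S i k = 0.
  move=> ki; apply/eqP/negPn/negP => Sik.
  (* With this direction tr (S E) = |S i k|^2 > 0, so a small step would push sigma_{-r} above its
     maximum [x]. *)
  pose E : 'M[C]_r := Num.conj (S i k) *: delta_mx k i.
  have Eup (a b : 'I_r) : (b <= a)%N -> E a b = 0.
    move=> ba; rewrite !mxE; case: eqP => [ak|]; last by rewrite mulr0.
    by case: eqP => [bi|]; rewrite ?mulr0 //; move: ki; rewrite -ak -bi ltnNge ba.
  have [P [c [Pc QP]]] := Qmx_perturb A mu Gamma Eup.
  have trpos : 0 < complex.Re (\tr (S *m E)).
    rewrite /E -scalemxAr mxtraceZ mxtrace_mul_delta -normCKC -[`|_|]/((normc _)%:C) -rmorphXn /=.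
    rewrite exprn_gt0 // lt_neqAle normc_ge0 andbT eq_sym.
    by apply: contraNneq Sik => /Normc.eq0_normc ->.
  rewrite -trS in trpos.
  have rN : (0 < r <= r * n)%N by rewrite r0 leq_pmulr.
  have [t [_ _]] := sigma_min_perturb rN sigx multx x0 nV QV UQ Pc trpos.
  by have [Gt <-] := QP t; rewrite ltNge opt.
(* Telescoping leaves the sum of U^* A_j V T^j minus that of T^j U^* A_j V; the right and left
   singular vector equations evaluate the two sums. *)
have comm : S *m T - T *m S = x%:C *: (U ^t* *m U - V ^t* *m V).
  rewrite mulmx_suml mulmx_sumr -sumrB.
  under eq_bigr => j _ do rewrite powmx_commutator.
  rewrite sumrB scalerBr; congr (_ - _).
    have QVm : mxeval A V T = x%:C *: U.
      by apply: (@vec_inj R); rewrite -Qmx_mul_vec QV linearZ.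
    by rewrite scalemxAr -QVm mulmx_sumr; apply: eq_bigr => j _; rewrite /G !mulmxA.
  by rewrite scalemxAl -(adjoint_Qmx UQ) mulmx_suml; apply: eq_bigr => j _; rewrite /G !mulmxA.
set K := U ^t* *m U - V ^t* *m V in comm.
(* [S] and [T] are upper triangular, so S T and T S share their diagonal and the commutator is
   strictly upper triangular. *)
have Kup (i j : 'I_r) : (j <= i)%N -> K i j = 0.
  move=> ji; apply: (mulfI (x := x%:C)); first by rewrite eq_complex /= eqxx andbT gt_eqF.
  have /matrixP/(_ i j) := comm; rewrite [RHS]mxE mulr0 => <-.
  rewrite mxE [X in _ + X]mxE !mulmx_diag_upper //.
  by have [->|_] := eqVneq i j; rewrite ?mulr0n ?subr0 // mulrC subrr.
have KH (i j : 'I_r) : K j i = Num.conj (K i j).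
  rewrite /K !mxE rmorphB !rmorph_sum; congr (_ - _); apply: eq_bigr => l _;
  by rewrite !mxE rmorphM /= conjCK mulrC.
apply/eqP; rewrite -subr_eq0; apply/eqP/matrixP => i j; rewrite -/K [RHS]mxE.
have [/Kup //|/ltnW ij] := leqP j i.
by rewrite KH Kup // rmorph0.
Qed.

End Optimality.

(** * Orthogonal projections and equal Gram matrices *)

Lemma gram_projection (K : numClosedFieldType) n (P : 'M[K]_n) (x : 'cV[K]_n) :
    P ^t* = P -> P *m P = P ->
  x ^t* *m x - (P *m x) ^t* *m (P *m x) = (x - P *m x) ^t* *m (x - P *m x).
Proof.
move=> PH PP; have -> : (x - P *m x) ^t* = x ^t* - (P *m x) ^t*.
  by apply/matrixP => i j; rewrite !mxE rmorphB.
rewrite trmx_mul map_mxM PH mulmxBl !mulmxBr !mulmxA -!(mulmxA _ P P) PP.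
by rewrite subrr subr0.
Qed.

Lemma gram_mulmx (K : numClosedFieldType) p q r (U V : 'M[K]_(p, q)) (y : 'M[K]_(q, r)) :
  U ^t* *m U = V ^t* *m V -> (U *m y) ^t* *m (U *m y) = (V *m y) ^t* *m (V *m y).
Proof.
move=> UV; rewrite !trmx_mul !map_mxM !mulmxA -(mulmxA _ (U ^t*)) UV.
by rewrite !mulmxA.
Qed.

(** * The distance *)

Section FinalSteps.
Variable R : realType.
Local Notation C := R[i].

Lemma mpinv_full_rank p q (M : 'M[C]_(p, q)) : \rank M = q -> mpinv M *m M = 1%:M.
Proof.
move=> rM; have [MXM _ _ _] := mpinvP M.
have Mfree : row_free M^T by rewrite /row_free mxrank_tr rM.
apply: trmx_inj; apply: (row_free_inj Mfree).
by rewrite -!trmx_mul mulmxA MXM mulmx1.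
Qed.

Lemma vnorm2_proj_le n (P : 'M[C]_n) (x : 'cV[C]_n) :
  P ^t* = P -> P *m P = P -> vnorm2 (P *m x) <= vnorm2 x.
Proof.
move=> PH PP; rewrite -(@ler_pXn2r _ 2) ?nnegrE ?vnorm2_ge0 // -subr_ge0.
suff -> : vnorm2 x ^+ 2 - vnorm2 (P *m x) ^+ 2 = vnorm2 (x - P *m x) ^+ 2 by exact: sqr_ge0.
apply: complexI; rewrite rmorphB /= !sqr_vnorm2_dot -(gram_projection x PH PP).
by rewrite [RHS]mxE; congr (_ + _); rewrite [RHS]mxE.
Qed.

Lemma vnorm2_gram p q (U V : 'M[C]_(p, q)) (y : 'cV[C]_q) :
  U ^t* *m U = V ^t* *m V -> vnorm2 (U *m y) = vnorm2 (V *m y).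
Proof.
move=> UV; apply/eqP; rewrite -(@eqrXn2 _ 2) ?vnorm2_ge0 //; apply/eqP/complexI.
by rewrite /= !sqr_vnorm2_dot (gram_mulmx _ UV).
Qed.

(** Equal Gram matrices allow [U] to be replaced by [V] under the norm, which leaves the orthogonal
    projection V V^+. *)
Lemma vnorm2_mul_mpinv_le p q (U V : 'M[C]_(p, q)) (x : 'cV[C]_p) :
  U ^t* *m U = V ^t* *m V -> vnorm2 (U *m mpinv V *m x) <= vnorm2 x.
Proof.
move=> UV; have [_ VXV VH _] := mpinvP V.
rewrite -mulmxA (vnorm2_gram _ UV) mulmxA.
by apply: vnorm2_proj_le => //; rewrite mulmxA -(mulmxA V) -(mulmxA V) VXV.
Qed.

Lemma sigma_min_le_mxnorm2 m n s r (A : 'I_m.+1 -> 'M[C]_n) (S : s.-tuple C) (D : 'M[C]_n) :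
    (0 < n)%N -> (0 < r)%N -> uniq S -> (r <= total_mult A S D)%N ->
  exists2 nu : r.-tuple C, tuples_of S r nu
    & forall Gamma, sigma_min r (Qmx A nu Gamma) <= mxnorm2 D.
Proof.
move=> n0 r0 S_uniq; rewrite /total_mult /eig_mult -(big_tuple _ _ S xpredT (fun x => mup x _)).
move=> /(sum_mup_dvdp S_uniq)[nu [nuS nu_dvd]]; exists nu => // Gamma.
have := invariant_pair_exists nu_dvd; rewrite size_tuple => -[X [T [Td XT obs]]].
apply: sigma_min_le => [|q B qr]; first by rewrite r0 leq_pmulr.
(* The q < r constraints of the Courant-Fischer test subspace, pulled back to [Z]. *)
pose g (Z : 'M[C]_r) := B *m vec (X *m Z).
have g_lin : linear g.
  by move=> a Y Z; rewrite /g mulmxDr -scalemxAr linearP mulmxDr -scalemxAr.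
pose gL : {linear 'M[C]_r -> 'cV[C]_q} := HB.pack g (GRing.isLinear.Build _ _ _ _ g g_lin).
have [Z [Z0 TZ gZ]] := upper_intertwiner_exists gL Td (Cmx_diag_upper nu Gamma) qr.
exists (vec (X *m Z)); split=> //.
  apply: contraNneq Z0 => XZ; apply/eqP; apply: obs TZ _; apply: (@vec_inj R).
  by rewrite XZ linear0.
rewrite Qmx_mul_vec.
suff /eqP : mxeval A (X *m Z) (Cmx nu Gamma) + D *m (X *m Z) = 0.
  by rewrite addr_eq0 => /eqP ->; rewrite linearN vnorm2N vnorm2_vec_mul.
(* The pair (X Z, C) inherits invariance from (X, T), as (lambda - T) Z = Z (lambda - C). *)
apply/invariant_pair_matpolyP; case: XT => E XT; exists (E *m map_mx polyC Z).
rewrite map_mxM mulmxA XT -!mulmxA; congr (_ *m _).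
by rewrite /char_poly_mx mulmxBl mulmxBr -!map_mxM TZ scalar_mxC.
Qed.

(** An invariant pair with left invertible [X] contributes its whole characteristic polynomial to
    the nonzero polynomial det (P + D). *)
Lemma total_mult_ge m n s r (A : 'I_m.+1 -> 'M[C]_n) (S : s.-tuple C) (D : 'M[C]_n)
    (mu : r.-tuple C) (Gamma : gammas r) (X : 'M[C]_(n, r)) (W : 'M[C]_(r, n)) :
    (1 <= m)%N -> \rank (A ord_max) = n -> uniq S -> tuples_of S r mu -> W *m X = 1%:M ->
    mxeval A X (Cmx mu Gamma) + D *m X = 0 ->
  (r <= total_mult A S D)%N.
Proof.
move=> m_ge1 rankAm S_uniq mu_S WX /invariant_pair_matpolyP[E XE].
rewrite /total_mult /eig_mult -(big_tuple _ _ S xpredT (fun x => mup x _)) -{1}(size_tuple mu).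
apply: leq_sum_mup => //; first exact: det_matpoly_neq0.
have [L' _ ->] := invariant_pair_factor WX XE; apply: dvdp_mull.
have -> : char_poly (Cmx mu Gamma) = \prod_(x <- mu) ('X - x%:P) => //.
(* [char_poly_trig] is about lower triangular matrices, hence the transposition. *)
rewrite big_tuple -[LHS]det_tr.
have -> : (char_poly_mx (Cmx mu Gamma))^T = char_poly_mx (Cmx mu Gamma)^T.
  by apply/matrixP => i j; rewrite !mxE eq_sym.
have -> : \det (char_poly_mx (Cmx mu Gamma)^T) = char_poly (Cmx mu Gamma)^T by [].
rewrite char_poly_trig; last first.
  apply/is_trig_mxP => i j ij.
  by rewrite mxE (Cmx_diag_upper _ _ (ltnW ij)) -val_eqE /= gtn_eqF.
by apply: eq_bigr => i _; rewrite mxE (Cmx_diag_upper _ _ (leqnn i)) eqxx (tnth_nth 0).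
Qed.

End FinalSteps.

Theorem theorem3p1 (R : realType) (m n s r : nat)
    (A : 'I_m.+1 -> 'M[R[i]]_n) (S : s.-tuple R[i])
    (m_ge1 : (1 <= m)%N) (rankAm : \rank (A ord_max) = n)
    (S_uniq : uniq S) (r_gt0 : (0 < r)%N)
    (mu : r.-tuple R[i]) (mu_S : tuples_of S r mu)
    (mu_min : kappa A mu = ereal_inf [set kappa A nu | nu in tuples_of S r])
    (Gamma : gammas r)
    (Gamma_max : (sigma_min r (Qmx A mu Gamma))%:E = kappa A mu)
    (U V : 'cV[R[i]]_(r * n)) (calU calV : 'M[R[i]]_(n, r))
    (U_unit : vnorm2 U = 1) (V_unit : vnorm2 V = 1)
    (QV : Qmx A mu Gamma *m V = (fine (kappa A mu))%:C *: U)
    (UQ : U ^t* *m Qmx A mu Gamma = (fine (kappa A mu))%:C *: V ^t*)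
    (U_vec : U = vec calU) (V_vec : V = vec calV)
    (multiplicity_assumption :
      singular_value_mult (Qmx A mu Gamma) (sigma_min r (Qmx A mu Gamma)) = 1%N)
    (linear_independence_assumption : \rank calV = r) :
  let Delta := - ((fine (kappa A mu))%:C *: (calU *m mpinv calV)) in
  [/\ tau A S r =
        ereal_inf [set ereal_sup [set (sigma_min r (Qmx A nu G))%:E
                                 | G in [set: gammas r]]
                  | nu in tuples_of S r],
      (r <= total_mult A S Delta)%N
    & (mxnorm2 Delta)%:E = tau A S r].
Proof.
have n_gt0 : (0 < n)%N.
  by apply: leq_trans r_gt0 _; rewrite -linear_independence_assumption rank_leq_row.
have [x sigx] : exists x, sigma_min r (Qmx A mu Gamma) = x by eexists.
rewrite sigx in Gamma_max multiplicity_assumption.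
have kE : fine (kappa A mu) = x by rewrite -Gamma_max.
rewrite kE in QV UQ *; subst U V => Delta.
have opt G : sigma_min r (Qmx A mu G) <= x.
  by rewrite -lee_fin Gamma_max; apply: ereal_sup_ubound; exists G.
have WV := mpinv_full_rank linear_independence_assumption.
have QVm : mxeval A calV (Cmx mu Gamma) = x%:C *: calU.
  by apply: (@vec_inj R); rewrite -Qmx_mul_vec QV linearZ.
have feasible : (r <= total_mult A S Delta)%N.
  apply: (@total_mult_ge _ _ _ _ _ _ _ _ mu Gamma _ _ m_ge1 rankAm S_uniq mu_S WV).
  by rewrite QVm /Delta mulNmx -scalemxAl -mulmxA WV mulmx1 subrr.
have x_ge0 : 0 <= x by rewrite -sigx sigma_min_ge0 // r_gt0 leq_pmulr.
have norm_le : mxnorm2 Delta <= x.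
  apply: mxnorm2_le => // y; rewrite /Delta mulNmx vnorm2N -scalemxAl vnorm2Z.
  rewrite normc_real ger0_norm //.
  (* For x = 0 the matrix [Delta] is zero; the first-order argument requires x > 0. *)
  move: x_ge0; rewrite le_eqVlt => /predU1P[<-|x_gt0]; first by rewrite !mul0r.
  rewrite ler_wpM2l ?(ltW x_gt0) //; apply: vnorm2_mul_mpinv_le.
  exact: (gram_eq_of_optimal n_gt0 r_gt0 x_gt0 sigx multiplicity_assumption opt V_unit QV UQ).
have lower D : (r <= total_mult A S D)%N -> x <= mxnorm2 D.
  move=> /(sigma_min_le_mxnorm2 n_gt0 r_gt0 S_uniq)[nu nuS nu_le].
  (* By minimality of [mu], x is at most kappa(nu), which is at most the norm of [D]. *)
  rewrite -lee_fin Gamma_max mu_min; apply: (@le_trans _ _ (kappa A nu)).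
    exact: (ereal_inf_lbound (ex_intro2 _ _ nu nuS erefl)).
  by apply: ge_ereal_sup => _ [G _ <-]; rewrite lee_fin.
have tauE : tau A S r = x%:E.
  apply/eqP; rewrite eq_le; apply/andP; split; last first.
    by apply: le_ereal_inf_tmp => _ [D /= /lower xD <-]; rewrite lee_fin.
  apply: (@le_trans _ _ (mxnorm2 Delta)%:E); last by rewrite lee_fin.
  by apply: ereal_inf_lbound; exists Delta.
split=> //; first by rewrite tauE Gamma_max mu_min.
by rewrite tauE; congr (_%:E); apply/le_anti; rewrite norm_le lower.
Qed.
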